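(* Let $I$ be a nonzero proper squarefree monomial ideal of $S=\mathbb{K}[x_1,\ldots,x_n]$. Suppose that $m$ and $k$ are positive integers. Then for every integer $j$ with $m-k\leq j\leq m$, we have $$\operatorname{reg}(I^{(km+j)})\geq \operatorname{reg}(I^{(m)})+(k-1)m+j.$$
   Context: $\mathbb{K}$ is a field and $S=\mathbb{K}[x_1,\ldots,x_n]$ is the (standard graded) polynomial ring in $n$ variables. For a graded $S$-module $M$ with graded Betti numbers $\beta_{i,j}(M)$ (so the minimal graded free resolution of $M$ has $i$-th term $\bigoplus_j S(-j)^{\beta_{i,j}(M)}$), the Castelnuovo--Mumford regularity is $\operatorname{reg}(M)=\max\{j-i : \beta_{i,j}(M)\neq 0\}$; ideals are regarded as graded $S$-modules. For an integer $m\geq 1$, the $m$-th symbolic power of a monomial ideal $I$ is $$I^{(m)}=\bigcap_{\mathfrak{p}\in \operatorname{Min}(I)} \operatorname{Ker}\big(S\rightarrow (S/I^m)_{\mathfrak{p}}\big),$$ where $\operatorname{Min}(I)$ is the set of minimal prime ideals of $I$. *)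

(* Defs.v *)
From HB Require Import structures.
From mathcomp Require Import all_boot all_order all_algebra.
From mathcomp.multinomials Require Import freeg mpoly.
From Stdlib Require Import ClassicalEpsilon.

Set Implicit Arguments.
Unset Strict Implicit.
Unset Printing Implicit Defensive.

Import GRing.Theory.
Local Open Scope ring_scope.

Section Ideals.

Variables (K : fieldType) (n : nat).
Local Notation S := {mpoly K[n]}.

Definition is_ideal (I : S -> Prop) : Prop :=
  [/\ I 0, (forall f g, I f -> I g -> I (f + g))
     & (forall c f, I f -> I (c * f))].

Definition ideal_gen (A : S -> Prop) (f : S) : Prop :=
  exists s : seq (S * S),
    (forall x, x \in s -> A x.2) /\ f = \sum_(x <- s) x.1 * x.2.

Definition ideal_pow (I : S -> Prop) (m : nat) : S -> Prop :=
  ideal_gen (fun f => exists2 t : 'I_m -> S,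
    forall i, I (t i) & f = \prod_i t i).

Definition prime_ideal (P : S -> Prop) : Prop :=
  [/\ is_ideal P, ~ P 1 & forall f g, P (f * g) -> P f \/ P g].

Definition minimal_prime (I P : S -> Prop) : Prop :=
  [/\ prime_ideal P, (forall f, I f -> P f)
     & forall Q : S -> Prop, prime_ideal Q -> (forall f, I f -> Q f) ->
         (forall f, Q f -> P f) -> forall f, P f -> Q f].

(* The pair (a, s), with s outside P, stands for the fraction a/s of the
   localization (S/J)_P; this is equality of fractions. *)
Definition frac_eq (J P : S -> Prop) (x y : S * S) : Prop :=
  exists2 u, ~ P u & J (u * (y.2 * x.1 - x.2 * y.1)).

Definition loc_ker (J P : S -> Prop) (f : S) : Prop :=
  frac_eq J P (f, 1) (0, 1).

Definition symbolic_power (I : S -> Prop) (m : nat) (f : S) : Prop :=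
  forall P, minimal_prime I P -> loc_ker (ideal_pow I m) P f.

Definition squarefree_monomial_ideal (I : S -> Prop) : Prop :=
  exists2 A : 'X_{1..n} -> Prop,
    (forall u, A u -> forall i, (u i <= 1)%N)
    & forall f, I f <-> ideal_gen (fun g => exists2 u, A u & g = 'X_[u]) f.

End Ideals.

Section Resolutions.

Variables (K : fieldType) (n : nat).
Local Notation S := {mpoly K[n]}.

(* True of 0 in every degree; in negative degree, true of 0 only. *)
Definition homog_of_degree (d : int) (f : S) : Prop :=
  forall u : 'X_{1..n}, u \in msupp f -> (mdeg u)%:Z = d.

(* The i-th term is F_i = \bigoplus_(a < res_rank i) S(- res_deg i a), its
   elements are row vectors, and matrices act on the right; res_dif i is the
   map F_{i+1} -> F_i and res_aug is the augmentation F_0 -> S. *)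
Record free_res := FreeRes {
  res_rank : nat -> nat;
  res_deg : forall i, 'I_(res_rank i) -> int;
  res_aug : 'cV[S]_(res_rank 0);
  res_dif : forall i, 'M[S]_(res_rank i.+1, res_rank i) }.

Definition is_graded (F : free_res) : Prop :=
  (forall a, homog_of_degree (res_deg a) (res_aug F a 0)) /\
  (forall i a b,
     homog_of_degree (res_deg a - res_deg b) (res_dif F i a b)).

Definition is_resolution_of (J : S -> Prop) (F : free_res) : Prop :=
  [/\ (forall f, J f <-> exists v : 'rV_(res_rank F 0), f = (v *m res_aug F) 0 0),
      (forall v : 'rV_(res_rank F 0),
         v *m res_aug F = 0 <-> exists w, v = w *m res_dif F 0)
    & (forall i (v : 'rV_(res_rank F i.+1)),
         v *m res_dif F i = 0 <-> exists w, v = w *m res_dif F i.+1)].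

(* The image of F_{i+1} lies in (x_1, ..., x_n) F_i. *)
Definition is_minimal (F : free_res) : Prop :=
  forall i a b, (res_dif F i a b)@_0%MM = 0.

Definition minimal_graded_free_resolution (J : S -> Prop) (F : free_res) :=
  [/\ is_graded F, is_resolution_of J F & is_minimal F].

Definition zero_res : free_res :=
  @FreeRes (fun _ => 0%N) (fun _ _ => 0) 0 (fun _ => 0).

(* Every homogeneous ideal J has a minimal graded free resolution, unique up
   to isomorphism; zero_res only witnesses that free_res is inhabited. *)
Definition min_res (J : S -> Prop) : free_res :=
  epsilon (inhabits zero_res) (minimal_graded_free_resolution J).

Definition betti (J : S -> Prop) (i : nat) (j : int) : nat :=
  #|[set a : 'I_(res_rank (min_res J) i) | res_deg a == j]|.

Definition is_max (E : int -> Prop) (r : int) : Prop :=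
  E r /\ forall e, E e -> e <= r.

Definition reg (J : S -> Prop) : int :=
  epsilon (inhabits 0) (is_max (fun e =>
    exists i j, betti J i j <> 0%N /\ e = j - i%:Z)).

End Resolutions.

(* Main.v *)
(* By the squarefree structure, a monomial x^u lies in I^(m) exactly when
   sum_{i in C} u_i >= m for every minimal cover C, i.e. for every minimal
   prime (x_i : i in C) of I.  The Betti numbers of I^(m) are computed by Koszul homology,
   which splits into multidegrees; the strand of multidegree a is the
   augmented chain complex of the upper Koszul complex
   {s : x^(a - s) in I^(m)}.  More generally, for g <= M one considers the
   complex of all s such that the exponent equal to g on s and to M off s is
   in the ideal; a coordinate edge g_v <= x <= M_v can be cut at x, and the
   pieces are related by a long exact sequence.  Cutting down to unit cells
   shows that homology of a large box comes from a Betti number in a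
   multidegree inside the box.  Conversely, if a realizes the regularity with
   |a| maximal, then its homology survives when M is raised far beyond m,
   because the obstruction would be a Betti number one homological step
   further and in a strictly larger degree.  For such M the complex only
   depends on the support of a and on which covers C satisfy
   sum_{i in C} (a_i - 1) >= m.  Hence it is unchanged when m becomes km + j
   and a - 1 becomes (k + 1)(a - 1), or, if |a - 1| < m, when a - 1 becomes
   (km + j - 1) e_v for some v in the support of a; the Betti number found
   inside the new box has the required degree. *)
Require Import Defs.
From mathcomp Require Import all_boot all_order all_algebra.
From mathcomp.multinomials Require Import freeg mpoly.
From mathcomp Require Import zify ring.
From Stdlib Require Import ClassicalEpsilon.

Set Implicit Arguments.
Unset Strict Implicit.
Unset Printing Implicit Defensive.

Import Order.TTheory GRing.Theory Num.Theory.
Local Open Scope ring_scope.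

(** * Koszul differentials on families indexed by sets of variables *)

Section KoszulDifferential.

Variables (n : nat) (R : comNzRingType) (V : lmodType R) (x : 'I_n -> R).
Implicit Types (c b : {set 'I_n} -> V) (s t : {set 'I_n}) (i j : 'I_n).

Definition kpos i s : nat := #|[set j in s | (j < i)%N]|.

Definition ksign i s : R := (-1) ^+ kpos i s.

(** A family [c] stands for the sum of all [c s] e_s, in all homological degrees at once, and
    [kd c t] is the coefficient of e_t in its boundary. With [x] constantly 1 this is the simplicial
    boundary, with the variables the Koszul one. *)
Definition kd c t : V := \sum_(i | i \notin t) (ksign i t * x i) *: c (i |: t).

Lemma eq_kd c b : c =1 b -> kd c =1 kd b.
Proof. by move=> e t; apply: eq_bigr => i _; rewrite e. Qed.

Lemma kdD c b t : kd (fun s => c s + b s) t = kd c t + kd b t.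
Proof. by rewrite /kd -big_split; apply: eq_bigr => i _; rewrite scalerDr. Qed.

Lemma kdB c b t : kd (fun s => c s - b s) t = kd c t - kd b t.
Proof. by rewrite /kd -sumrB; apply: eq_bigr => i _; rewrite scalerBr. Qed.

Lemma kd0 t : kd (fun _ => 0) t = 0.
Proof. by rewrite /kd big1 // => i _; rewrite scaler0. Qed.

Lemma kposU1 i j s : j \notin s -> kpos i (j |: s) = ((j < i) + kpos i s)%N.
Proof.
move=> js; rewrite /kpos.
case: (boolP (j < i)%N) => ji.
  rewrite -[RHS](_ : #|j |: [set k in s | (k < i)%N]| = _).
    apply: eq_card => k; rewrite !inE; case: eqP => // -> /=; exact: ji.
  by rewrite cardsU1 inE (negbTE js).
rewrite add0n; apply: eq_card => k; rewrite !inE; case: eqP => // ->.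
by rewrite (negbTE ji) (negbTE js).
Qed.

Lemma ksignU1 i j s : j \notin s ->
  ksign i (j |: s) = (-1) ^+ (j < i)%N * ksign i s.
Proof. by move=> js; rewrite /ksign kposU1 // exprD. Qed.

Lemma ksign_sq i s : ksign i s * ksign i s = 1.
Proof. by rewrite /ksign -exprD addnn -mul2n mulnC exprM sqrr_sign. Qed.

Lemma ksign_anti i j s : i != j -> i \notin s -> j \notin s ->
  ksign i s * ksign j (i |: s) = - (ksign j s * ksign i (j |: s)).
Proof.
move=> ij is_ js; rewrite !ksignU1 //.
have -> : (i < j)%N = ~~ (j < i)%N.
  by case: ltngtP ij => // e; rewrite (val_inj e) eqxx.
by case: (j < i)%N; rewrite /= ?expr0 ?expr1; ring.
Qed.

Lemma ksignU1_anti i j s : i != j -> i \notin s -> j \notin s ->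
  ksign i (j |: s) * ksign j (i |: s) = - (ksign j s * ksign i s).
Proof.
move=> ij is_ js; rewrite !ksignU1 //.
have -> : (i < j)%N = ~~ (j < i)%N.
  by case: ltngtP ij => // e; rewrite (val_inj e) eqxx.
by case: (j < i)%N; rewrite /= ?expr0 ?expr1; ring.
Qed.

(* The terms (i, j) and (j, i) are cancelled in pairs: proving that the sum is
   its own opposite would not suffice in characteristic 2. *)
Lemma kd_kd c t : kd (kd c) t = 0.
Proof.
rewrite /kd.
under eq_bigr => i _ do rewrite scaler_sumr.
rewrite (eq_bigr (fun i => \sum_(j | (j \notin t) && (j != i))
   ((ksign i t * x i) * (ksign j (i |: t) * x j)) *: c (i |: (j |: t)))); last first.
  move=> i it; apply: eq_big => [j|j _]; first by rewrite !inE negb_or andbC.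
  by rewrite scalerA setUCA.
rewrite pair_big_dep /=.
rewrite (bigID (fun p : 'I_n * 'I_n => (p.1 < p.2)%N)) /=.
rewrite [X in _ + X](reindex_inj (h := fun p : 'I_n * 'I_n => (p.2, p.1))) /=; last first.
  by move=> [a b] [a' b'] [-> ->].
apply/eqP; rewrite addrC addr_eq0 -sumrN; apply/eqP.
apply: eq_big => [[i j]|[i j]] /=.
  rewrite [j == i]eq_sym -!(inj_eq val_inj) /=.
  by case: (i \in t); case: (j \in t); case: ltngtP.
move=> /andP[/and3P[jt it ij] _]; rewrite (setUCA [set j]) -scaleNr; congr (_ *: _).
have := ksign_anti ij it jt.
set a := ksign i t; set b := ksign j _; set a' := ksign j t; set b' := ksign i _.
move=> e; have -> : a' * x j * (b' * x i) = a' * b' * (x i * x j) by ring.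
by rewrite -[a' * b']opprK -e; ring.
Qed.

End KoszulDifferential.

(** * Acyclicity of complexes of sets: cones and long exact sequences *)

Section SimplicialHomology.

Variables (n : nat) (R : comNzRingType) (V : lmodType R).
Implicit Types (c b : {set 'I_n} -> V) (s t : {set 'I_n}) (i j v : 'I_n).

Local Notation kd1 := (@kd n R V (fun _ => 1)).

(** The degree is the cardinality, so the empty face sits in degree 0 and the homology is the
    reduced one with its index shifted by one. *)
Definition simplicial_chain (Q : {set 'I_n} -> Prop) p c :=
  forall s, c s != 0 -> Q s /\ #|s| = p.

Definition simplicial_acyclic (Q : {set 'I_n} -> Prop) p : Prop :=
  forall c, simplicial_chain Q p c -> (forall s, kd1 c s = 0) ->
  exists2 b, simplicial_chain Q p.+1 b & forall s, c s = kd1 b s.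

Definition join_vertex v c s : V :=
  if v \in s then ksign R v (s :\ v) *: c (s :\ v) else 0.

(** The homotopy formula dh + hd = 1 for the join h with [v]. The term at [v] gives [c t]; the
    others cancel by [ksignU1_anti]. *)
Lemma kd_join_vertex v c t :
  kd1 (join_vertex v c) t = c t - join_vertex v (kd1 c) t.
Proof.
rewrite /kd /join_vertex; case: ifPn => vt; last first.
  rewrite (bigD1 v) //= big1 ?addr0 => [|i /andP[it iv]]; last first.
    rewrite 2!inE eq_sym (negbTE iv) (negbTE vt) scaler0 //.
  by rewrite setU11 setU1K // scalerA mulr1 ksign_sq scale1r subr0.
apply/eqP; rewrite eq_sym subr_eq; apply/eqP.
rewrite [X in _ = _ + _ *: X](bigD1 v) ?inE ?eqxx //= setD1K // scalerDr !scalerA mulr1.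
rewrite ksign_sq scale1r addrCA -[LHS]addr0; congr (_ + _).
rewrite scaler_sumr [X in _ = _ + X](eq_bigl (fun i => i \notin t)) => [|i]; last first.
  by rewrite !inE; case: (i =P v) => [->|_]; rewrite ?vt ?andbF ?andbT.
rewrite -big_split /= big1 // => i it; rewrite inE vt orbT.
have iv : i != v by apply: contraNneq it => ->.
have -> : (i |: t) :\ v = i |: t :\ v.
  by apply/setP => k; rewrite !inE; case: (k =P v) => // ->; rewrite eq_sym (negbTE iv).
rewrite !scalerA -scalerDl !mulr1 -[X in ksign R i X](setD1K vt).
have vs : v \notin t :\ v by rewrite !inE eqxx.
have is_ : i \notin t :\ v by rewrite !inE negb_and it orbT.
by rewrite ksignU1_anti // addNr scale0r.
Qed.

Lemma simplicial_acyclic_cone (Q : {set 'I_n} -> Prop) v p :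
  (forall s, Q s -> Q (v |: s)) -> simplicial_acyclic Q p.
Proof.
move=> cone c Qc dc; exists (join_vertex v c) => s; last first.
  by rewrite kd_join_vertex /join_vertex dc scaler0 if_same subr0.
rewrite /join_vertex; case: ifP => [vs|_]; last by rewrite eqxx.
case: (eqVneq (c (s :\ v)) 0) => [->|/Qc[Qs <-] _]; first by rewrite scaler0 eqxx.
by split; [rewrite -(setD1K vs); apply: cone | rewrite (cardsD1 v s) vs].
Qed.

(* Chain groups of the mapping cone of an inclusion A -> B in direction v. *)
Definition edge_support v (A B : {set 'I_n} -> Prop) s := if v \in s then A s else B s.

Lemma kd1D1 c v s : v \notin s -> (forall t, v \notin t -> c t = 0) ->
  kd1 c s = ksign R v s *: c (v |: s).
Proof.
move=> vs c0; rewrite /kd (bigD1 v) //= mulr1 big1 ?addr0 // => i /andP[is_ iv].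
by rewrite c0 ?scaler0 // !inE negb_or vs eq_sym iv.
Qed.

Lemma kd1_in0 c v s : v \in s -> (forall t, v \in t -> c t = 0) -> kd1 c s = 0.
Proof.
move=> vs c0; rewrite /kd big1 // => i is_.
by rewrite c0 ?scaler0 // inE vs orbT.
Qed.

Section LongExactSequence.

Variables (v : 'I_n) (A B C : {set 'I_n} -> Prop).
Hypotheses (AB : forall s, A s -> B s) (BC : forall s, B s -> C s).
Hypothesis B_indep : forall s, B (v |: s) <-> B s.

Local Notation low c := (fun s => if v \in s then 0 else c s : V).
Local Notation high c := (fun s => if v \in s then c s else 0 : V).

Lemma kd1_low_high c s : kd1 c s = kd1 (low c) s + kd1 (high c) s.
Proof. by rewrite -kdD; apply: eq_kd => t; case: ifP; rewrite ?add0r ?addr0. Qed.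

Lemma kd1_low c s : v \in s -> kd1 (low c) s = 0.
Proof. by move=> vs; apply: kd1_in0 vs _ => t ->. Qed.

Lemma kd1_high c s : v \notin s -> kd1 (high c) s = ksign R v s *: c (v |: s).
Proof. by move=> vs; rewrite (@kd1D1 _ v) ?setU11 // => t /negbTE->. Qed.

Lemma chainD Q p c b : simplicial_chain Q p c -> simplicial_chain Q p b ->
  simplicial_chain Q p (fun s => c s + b s).
Proof.
move=> Qc Qb s; case: (eqVneq (c s) 0) => [->|/Qc //].
by rewrite add0r => /Qb.
Qed.

Lemma sub_chain Q Q' p c : (forall s, Q s -> Q' s) ->
  simplicial_chain Q p c -> simplicial_chain Q' p c.
Proof. by move=> QQ' Qc s /Qc[/QQ']. Qed.

(** This is the connecting map: off [v], the boundary of the part through [v] lives in [B], because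
    [B_indep] removes [v] from its faces. *)
Lemma high_chain Q p c s : simplicial_chain (edge_support v B Q) p.+1 c ->
  v \notin s -> kd1 (high c) s != 0 -> B s /\ #|s| = p.
Proof.
move=> Bc vs; rewrite kd1_high // => nz.
have /Bc[] : c (v |: s) != 0 by apply: contraNneq nz => ->; rewrite scaler0.
by rewrite /edge_support setU11 => /B_indep ? ; rewrite cardsU1 vs add1n => -[].
Qed.

(* The three cones form a short exact sequence up to homotopy; this is the
   exactness of its long homology sequence at H_p(A -> C). *)
Lemma acyclic_edge_trans p :
  simplicial_acyclic (edge_support v A B) p ->
  simplicial_acyclic (edge_support v B C) p ->
  simplicial_acyclic (edge_support v A C) p.
Proof.
move=> HAB HBC z Zz dz.
have [w Ww zw] : exists2 b, simplicial_chain (edge_support v B C) p.+1 b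
                  & forall s, z s = kd1 b s.
  by apply: HBC => //; apply: sub_chain Zz => s; rewrite /edge_support;
    case: ifP => // _ /AB.
(* Removing the boundary of the part of [w] off [v] leaves a chain of the cone from [A] to [B]: at
   faces off [v] only the boundary of the part through [v] remains. *)
have [b Bb zb] : exists2 b, simplicial_chain (edge_support v A B) p.+1 b
                  & forall s, z s - kd1 (low w) s = kd1 b s.
  apply: HAB => s; last by rewrite kdB kd_kd dz subr0.
  case: (boolP (v \in s)) => vs.
    by rewrite kd1_low // subr0 => /Zz; rewrite /edge_support vs.
  by rewrite zw kd1_low_high addrAC subrr add0r /edge_support (negbTE vs) => /(high_chain Ww vs).
exists (fun s => b s + low w s) => [|s]; last by rewrite kdD -zb subrK.
apply: chainD; first by apply: sub_chain Bb => s; rewrite /edge_support;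
  case: ifP => // _ /BC.
move=> s; case: ifPn => vs; first by rewrite eqxx.
by move=> /Ww; rewrite /edge_support (negbTE vs).
Qed.

(* Exactness of the same sequence at H_p(A -> B). *)
Lemma acyclic_edge_initial p :
  simplicial_acyclic (edge_support v A C) p ->
  simplicial_acyclic (edge_support v B C) p.+1 ->
  simplicial_acyclic (edge_support v A B) p.
Proof.
move=> HAC HBC z Zz dz.
have [w Ww zw] : exists2 b, simplicial_chain (edge_support v A C) p.+1 b
                  & forall s, z s = kd1 b s.
  by apply: HAC => //; apply: sub_chain Zz => s; rewrite /edge_support;
    case: ifP => // _ /BC.
(* Since [z] is a cycle, its join with [v] also has boundary [z]; hence [w] minus that join is a
   cycle, in the cone from [B] to [C]. *)
have [u Uu yu] : exists2 b, simplicial_chain (edge_support v B C) p.+2 b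
                  & forall s, w s + (- join_vertex v z s) = kd1 b s.
  apply: HBC => [|s]; last first.
    by rewrite kdB -zw kd_join_vertex /join_vertex dz scaler0 if_same subr0 subrr.
  apply: chainD; first by apply: sub_chain Ww => s; rewrite /edge_support;
    case: ifP => // _ /AB.
  move=> s; rewrite oppr_eq0 /join_vertex /edge_support; case: ifP => [vs|];
    last by rewrite eqxx.
  case: (eqVneq (z (s :\ v)) 0) => [->|/Zz[]]; first by rewrite scaler0 eqxx.
  rewrite /edge_support !inE eqxx /= => /B_indep; rewrite setD1K // => Bs <- _.
  by rewrite (cardsD1 v s) vs.
(* Changing [w] by a boundary keeps its boundary [z]. Off [v], where the join vanishes, what remains
   is the boundary of the part of [u] through [v], which lies in [B]. *)
exists (fun s => w s - kd1 (low u) s) => s; last by rewrite kdB kd_kd subr0 zw.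
rewrite /edge_support; case: ifPn => vs.
  by rewrite kd1_low // subr0 => /Ww; rewrite /edge_support vs.
have -> : w s - kd1 (low u) s = kd1 (high u) s.
  have := yu s; rewrite kd1_low_high /join_vertex (negbTE vs) subr0 => ->.
  by rewrite addrAC subrr add0r.
exact: high_chain Uu vs.
Qed.

End LongExactSequence.

End SimplicialHomology.

(** * Complexes attached to boxes of exponents, and cutting of boxes *)

Section BoxComplexes.

Variables (n : nat) (R : comNzRingType) (V : lmodType R).
Implicit Types (g d u M : 'X_{1..n}) (s : {set 'I_n}) (v : 'I_n).

Local Notation acyclic := (@simplicial_acyclic n R V).

Lemma eq_acyclic (Q Q' : {set 'I_n} -> Prop) p : (forall s, Q s <-> Q' s) ->
  acyclic Q p -> acyclic Q' p.
Proof.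
move=> QQ' H c Qc /(H c)[|b Qb cb]; first by move=> s /Qc[/QQ'].
by exists b => // s /Qb[/QQ'].
Qed.

Lemma acyclic_void (Q : {set 'I_n} -> Prop) p : (forall s, ~ Q s) -> acyclic Q p.
Proof.
move=> Q0 c Qc _; exists (fun _ => 0) => s; first by rewrite eqxx.
by rewrite kd0; apply/eqP; apply: contra_notT (Q0 s) => /Qc[].
Qed.

Definition mix g M s : 'X_{1..n} := [multinom if i \in s then g i else M i | i < n].
Definition upd M v x : 'X_{1..n} := [multinom if i == v then x else M i | i < n].
Definition succm g : 'X_{1..n} := [multinom (g i).+1 | i < n].

Variable P : 'X_{1..n} -> Prop.
Hypothesis P_up : forall u w : 'X_{1..n}, (forall i, (u i <= w i)%N) -> P u -> P w.

(* For the box [g, g + 1] this is the upper Koszul complex of the ideal, in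
   exponents shifted by 1 so that no negative entries occur. *)
Definition box g M s := P (mix g M s).

Lemma box_updl g M v x s : v \notin s -> box (upd g v x) M s <-> box g M s.
Proof.
move=> vs; rewrite /box; have -> // : mix (upd g v x) M s = mix g M s.
apply/mnmP => i; rewrite !mnmE; case: ifP => // is_.
by case: eqP is_ vs => // -> ->.
Qed.

Lemma box_updr g M v x s : v \in s -> box g (upd M v x) s <-> box g M s.
Proof.
move=> vs; rewrite /box; have -> // : mix g (upd M v x) s = mix g M s.
apply/mnmP => i; rewrite !mnmE; case: ifPn => // is_.
by case: eqP is_ => // ->; rewrite vs.
Qed.

Lemma box_mono g g' M M' s : (forall i, g i <= g' i)%N -> (forall i, M i <= M' i)%N ->
  box g M s -> box g' M' s.
Proof. by move=> gg MM; apply: P_up => i; rewrite !mnmE; case: ifP. Qed.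

Section Split.

Variables (g M : 'X_{1..n}) (v : 'I_n) (x : nat) (p : nat).
Hypothesis gx : (g v <= x <= M v)%N.

(** [A], [B] and [C] are the sections with coordinate [v] frozen at [g v], [x] and [M v]. The box is
    the cone from [A] to [C]; its lower and upper pieces are the cones from [A] to [B] and from [B]
    to [C]. *)
Let A := box g (upd M v (g v)).
Let B := box (upd g v x) (upd M v x).
Let C := box (upd g v (M v)) M.

Let AB s : A s -> B s.
Proof. by apply: box_mono => i; rewrite !mnmE; case: eqP => [e|]; rewrite ?e; lia. Qed.
Let BC s : B s -> C s.
Proof. by apply: box_mono => i; rewrite !mnmE; case: eqP => [e|]; rewrite ?e; lia. Qed.

Let B_indep s : B (v |: s) <-> B s.
Proof.
rewrite /B /box; have -> // : mix (upd g v x) (upd M v x) (v |: s) = mix (upd g v x) (upd M v x) s.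
by apply/mnmP => i; rewrite !mnmE !inE; case: eqP; rewrite //= if_same.
Qed.

Let edgeAB s : edge_support v A B s <-> box g (upd M v x) s.
Proof.
rewrite /edge_support; case: ifPn => vs; rewrite /A /B.
  by rewrite !box_updr.
by rewrite box_updl.
Qed.

Let edgeBC s : edge_support v B C s <-> box (upd g v x) M s.
Proof.
rewrite /edge_support; case: ifPn => vs; rewrite /B /C.
  by rewrite !box_updr.
by rewrite !box_updl.
Qed.

Let edgeAC s : edge_support v A C s <-> box g M s.
Proof.
rewrite /edge_support; case: ifPn => vs; rewrite /A /C.
  by rewrite !box_updr.
by rewrite !box_updl.
Qed.

Lemma box_acyclic_trans : acyclic (box g (upd M v x)) p ->
  acyclic (box (upd g v x) M) p -> acyclic (box g M) p.
Proof.
move=> H1 H2; apply: (eq_acyclic edgeAC); apply: (acyclic_edge_trans AB BC B_indep).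
  by apply: eq_acyclic H1 => s; rewrite edgeAB.
by apply: eq_acyclic H2 => s; rewrite edgeBC.
Qed.

Lemma box_acyclic_initial : acyclic (box g M) p ->
  acyclic (box (upd g v x) M) p.+1 -> acyclic (box g (upd M v x)) p.
Proof.
move=> H1 H2; apply: (eq_acyclic edgeAB); apply: (acyclic_edge_initial AB BC B_indep).
  by apply: eq_acyclic H1 => s; rewrite edgeAC.
by apply: eq_acyclic H2 => s; rewrite edgeBC.
Qed.

End Split.

(** Induction on the sum of the edge lengths. An edge longer than 1 is cut at [(g v).+1], and one
    piece keeps homology; an edge of length 0 makes the box a cone; otherwise the box is a unit
    cell. *)
Lemma box_unit_cell g M p : (forall i, g i <= M i)%N -> ~ acyclic (box g M) p ->
  exists2 b, ~ acyclic (box b (succm b)) p &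
    (forall i, g i <= b i)%N.
Proof.
have [k] := ubnP (\sum_i (M i - g i))%N.
elim: k g M => // k IH g M lek gM nac.
have sum_lt (F G : 'I_n -> nat) v : (forall i, F i <= G i)%N -> (F v < G v)%N ->
    (\sum_i F i < \sum_i G i)%N.
  move=> FG FGv; rewrite (bigD1 v) //= [X in (_ < X)%N](bigD1 v) //= -addSn.
  by rewrite leq_add // leq_sum.
case: (pickP (fun v => (g v).+1 < M v)%N) => [v vlt|noM].
  have gx : (g v <= (g v).+1 <= M v)%N by lia.
  case: (classic (acyclic (box g (upd M v (g v).+1)) p)) => [H1|H1].
    case: (classic (acyclic (box (upd g v (g v).+1) M) p)) => [H2|H2].
      by case: nac; apply: box_acyclic_trans H1 H2.
    have [||b Hb le_b] := IH _ _ _ _ H2.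
    - rewrite ltnS in lek; apply: leq_trans lek; apply: (sum_lt _ _ v) => [i|];
        rewrite mnmE ?eqxx; last lia.
      by case: eqP => [->|]; lia.
    - by move=> i; rewrite mnmE; case: eqP => [->|//]; lia.
    - exists b => // i; have := le_b i; rewrite mnmE; case: eqP => [->|//]; lia.
  have [||b Hb le_b] := IH _ _ _ _ H1.
  - rewrite ltnS in lek; apply: leq_trans lek; apply: (sum_lt _ _ v) => [i|];
      rewrite mnmE ?eqxx; last lia.
    by case: eqP => [->|]; lia.
  - by move=> i; rewrite mnmE; case: eqP => [->|//]; lia.
  - by exists b.
case: (pickP (fun v => g v == M v)%N) => [v /eqP vlt|noE].
  case: nac; apply: (@simplicial_acyclic_cone _ _ _ _ v) => s.
  rewrite /box; have -> // : mix g M (v |: s) = mix g M s.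
  by apply/mnmP => i; rewrite !mnmE !inE; case: eqP => //= ->; rewrite vlt if_same.
exists g => //; have <- // : M = succm g.
apply/mnmP => i; rewrite mnmE; have := gM i; have := noM i; have := noE i; lia.
Qed.

(* Cutting off the layer above g_v + 1 in direction v: a cycle that dies in the
   larger box comes from H_{p+1} of the layer, hence from a unit cell b > g. *)
Lemma box_raise g M p : (forall i, g i < M i)%N ->
  (forall b : 'X_{1..n}, (forall i, g i <= b i)%N -> b <> g -> acyclic (box b (succm b)) p.+1) ->
  ~ acyclic (box g (succm g)) p -> ~ acyclic (box g M) p.
Proof.
move=> gM gmax nac; have [k] := ubnP (\sum_i (M i - (g i).+1))%N.
elim: k M gM => // k IH M gM lek ac.
case: (pickP (fun v => (g v).+1 < M v)%N) => [v vlt|noM]; last first.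
  case: nac; have <- // : M = succm g.
  apply/mnmP => i; rewrite mnmE; have := gM i; have := noM i; lia.
have gx : (g v <= (g v).+1 <= M v)%N by lia.
apply: (IH (upd M v (g v).+1)) => [i||].
- by rewrite mnmE; case: eqP => [->|].
- rewrite ltnS in lek; apply: leq_trans lek.
  rewrite (bigD1 v) //= [X in (_ < X)%N](bigD1 v) //= mnmE eqxx subnn add0n.
  have -> : (\sum_(i < n | i != v) (upd M v (g v).+1 i - (g i).+1) =
      \sum_(i < n | i != v) (M i - (g i).+1))%N.
    by apply: eq_bigr => i /negbTE iv; rewrite mnmE iv.
  by rewrite -[X in (X < _)%N]add0n ltn_add2r subn_gt0.
apply: box_acyclic_initial => //; apply: NNPP.
move=> /box_unit_cell[i|b Hb le_b]; first by rewrite mnmE; case: eqP => [->|_];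
  [lia|apply: ltnW].
apply: Hb; apply: gmax => [i|e].
  by have := le_b i; rewrite mnmE; case: eqP => [->|//]; lia.
by have := le_b v; rewrite mnmE eqxx e; lia.
Qed.

End BoxComplexes.

(** * Boxes for the ideal defined by covers, and comparison of two powers *)

Section SymbolicPowerComplexes.

Variables (n : nat) (R : comNzRingType) (V : lmodType R).
Implicit Types (a b u M : 'X_{1..n}) (s : {set 'I_n}) (v : 'I_n).
Variable cover : {set 'I_n} -> Prop.

Local Notation acyclic := (@simplicial_acyclic n R V).

Definition cover_pow m u :=
  (forall i, 0 < u i)%N /\ forall C, cover C -> (m <= \sum_(i in C) (u i).-1)%N.

Lemma cover_pow_up m u (w : 'X_{1..n}) : (forall i, (u i <= w i)%N) -> cover_pow m u -> cover_pow m w.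
Proof.
move=> uw [u0 uC]; split=> [i|C /uC]; first exact: leq_trans (u0 i) (uw i).
by move/leq_trans; apply; apply: leq_sum => i _; have := uw i; lia.
Qed.

Local Notation cell m a := (box (cover_pow m) a (succm a)).

(** If [v] lies in [C], its entry alone contributes at least [m], even when [v] is in the face; so
    adding [v] to a face never destroys membership, and the cell is a cone. *)
Lemma cell_acyclic_large m a v p : (m < a v)%N -> acyclic (cell m a) p.
Proof.
move=> mv; apply: (@simplicial_acyclic_cone _ _ _ _ v) => s [c0 cC]; split=> [i|C CC].
  have := c0 i; rewrite !mnmE !inE; case: eqP => [->|//] _ /=; exact: leq_ltn_trans mv.
case: (boolP (v \in C)) => vC.
  by rewrite (bigD1 v) //= mnmE setU11; apply: leq_trans (leq_addr _ _); lia.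
apply: leq_trans (cC C CC) _; apply: leq_sum => i iC; rewrite !mnmE !inE.
by case: eqP iC vC => // -> ->.
Qed.

(** A variable of the support outside [s] has an entry above [m] and alone satisfies every cover
    through it. Only covers meeting the support inside [s] impose a condition, and their weight is
    read off from [a]. *)
Lemma box_large m a M s : (forall i, a i = 0 -> M i = 1)%N ->
  (forall i, 0 < a i -> m < M i)%N ->
  box (cover_pow m) a M s <-> (forall i, i \in s -> 0 < a i)%N /\
    (forall C, cover C -> (forall i, i \in C -> 0 < a i -> i \in s)%N ->
       (m <= \sum_(i in C) (a i).-1)%N).
Proof.
move=> M1 M2; split=> [[c0 cC]|[c0 cC]].
  split=> [i is_|C CC Cs]; first by have := c0 i; rewrite mnmE is_.
  apply: leq_trans (cC C CC) _; apply: leq_sum => i iC; rewrite !mnmE.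
  case: ifPn => // is_; case: (posnP (a i)) => [/M1->//|a0].
  by rewrite (Cs i iC a0) in is_.
split=> [i|C CC].
  rewrite mnmE; case: ifP => [/c0//|_]; case: (posnP (a i)) => [/M1->//|/M2]; lia.
case: (pickP (fun i => [&& i \in C, (0 < a i)%N & i \notin s])) => [i /and3P[iC a0 is_]|h].
  rewrite (bigD1 i) //= mnmE (negbTE is_); apply: leq_trans (leq_addr _ _).
  by have := M2 _ a0; lia.
apply: leq_trans (cC C CC _) _ => [i iC a0|].
  by have := h i; rewrite iC a0 /= => /negbFE.
apply: leq_sum => i iC; rewrite mnmE; case: ifPn => // is_.
by have := h i; rewrite iC is_ andbT /= lt0n => /negbFE/eqP->.
Qed.

(** Homology survives in a huge box by [box_raise], the two huge boxes carry the same complex by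
    [box_large], and cutting down the second one yields [b]. *)
Lemma box_compare m m' a a' p :
  (forall i, (0 < a i) = (0 < a' i))%N ->
  (forall C, cover C -> (m <= \sum_(i in C) (a i).-1) = (m' <= \sum_(i in C) (a' i).-1))%N ->
  (forall b : 'X_{1..n}, (forall i, a i <= b i)%N -> b <> a -> acyclic (cell m b) p.+1) ->
  ~ acyclic (cell m a) p -> exists2 b, ~ acyclic (cell m' b) p & (forall i, a' i <= b i)%N.
Proof.
move=> aa' CC amax nac.
(* The far corner: beyond both [m] and [a] on the support, and 1 (exponent 0) elsewhere, which is
   still strictly above [a] as [box_raise] requires. *)
pose N a m : 'X_{1..n} := [multinom if (0 < a i)%N then maxn m.+1 (a i).+1 else 1%N | i < n].
have N1 b q i : (b i = 0 -> N b q i = 1)%N by rewrite mnmE => ->.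
have N2 b q i : (0 < b i -> q < N b q i)%N by rewrite mnmE => ->; rewrite leq_max leqnn.
have N3 b q i : (b i < N b q i)%N.
  by rewrite mnmE; case: posnP => [->//|_]; rewrite leq_max leqnn orbT.
have := box_raise (@cover_pow_up m) (N3 a m) amax nac.
move=> nacM; apply: (@box_unit_cell _ _ _ _ (@cover_pow_up m') a' (N a' m')) => [i|ac].
  exact: ltnW.
apply: nacM; apply: eq_acyclic ac => s.
rewrite (box_large s (N1 a m) (N2 a m)) (box_large s (N1 a' m') (N2 a' m')).
split=> -[h1 h2].
- split=> [i /h1|C cC Cs]; first by rewrite aa'.
  by rewrite CC //; apply: h2 => // i iC; rewrite -aa'; apply: Cs.
- split=> [i /h1|C cC Cs]; first by rewrite aa'.
  by rewrite -CC //; apply: h2 => // i iC; rewrite aa'; apply: Cs.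
Qed.

(* With entries shifted by 1, a - 1 is replaced by (k + 1)(a - 1) if |a - 1| >= m
   and by (m' - 1) e_v, with v in the support of a, otherwise. *)
Lemma cell_scale m m' k a p : (0 < m)%N -> (k.+1 * m.-1 < m' <= k.+1 * m)%N ->
  (exists C, cover C) ->
  (forall b : 'X_{1..n}, (forall i, a i <= b i)%N -> b <> a -> acyclic (cell m b) p.+1) ->
  ~ acyclic (cell m a) p ->
  exists2 b, ~ acyclic (cell m' b) p & (mdeg a + m' <= mdeg b + m)%N.
Proof.
move=> m0 mm' [C0 cC0] amax nac.
have degle (a' b : 'X_{1..n}) : (forall i, a' i <= b i)%N -> (mdeg a' <= mdeg b)%N.
  by move=> le; rewrite !mdegE leq_sum.
case: (leqP m (\sum_i (a i).-1)%N) => Hm.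
  pose a' : 'X_{1..n} := [multinom if (0 < a i)%N then (k.+1 * (a i).-1).+1 else 0%N | i < n].
  have [||//|//|b nb /degle lb] := @box_compare m m' a a' p.
  - by move=> i; rewrite mnmE; case: (posnP (a i)).
  - move=> C _; have -> : (\sum_(i in C) (a' i).-1 = k.+1 * \sum_(i in C) (a i).-1)%N.
      by rewrite big_distrr /=; apply: eq_bigr => i _; rewrite mnmE;
        case: posnP => [->|_] /=; rewrite ?muln0.
    (* If x <= m - 1, then (k+1)x <= (k+1)(m-1) < [m']; if x >= m, then (k+1)x >= (k+1)m >= [m']. *)
    move: (\sum_(i in C) _)%N => x; case: (leqP m x) => mx; last first.
      by apply/esym/negbTE; rewrite -ltnNge; case/andP: mm' => h _; nia.
    by apply/esym; case/andP: mm' => _ h; nia.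
  exists b => //; apply: (@leq_trans (mdeg a' + m)); last by rewrite leq_add2r.
  have -> : (mdeg a' = mdeg a + k * \sum_i (a i).-1)%N.
    rewrite !mdegE big_distrr -big_split; apply: eq_bigr => i _ /=.
    by rewrite mnmE; case: posnP => [->|]; lia.
  (* The degree gained is k|a - 1| >= km >= [m'] - m. *)
  by case/andP: mm' => _; nia.
case: (pickP (fun v => 0 < a v)%N) => [v av|a0]; last first.
  (* If [a] is zero, every weight is 0 < m, so the cover [C0] excludes all faces. *)
  case: nac; apply: acyclic_void => s [c0 /(_ _ cC0)].
  rewrite big1 ?leqn0 => [|i _]; first by move: m0; case: (m).
  rewrite !mnmE; case: ifP => [is_|_].
    by have := a0 i; case: (a i).
  by have := a0 i; case: (a i).
pose a' : 'X_{1..n} := [multinom if (0 < a i)%N then (if i == v then m' else 1%N) else 0%N | i < n].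
have m'0 : (0 < m')%N by case/andP: mm'; lia.
have [||//|//|b nb /degle lb] := @box_compare m m' a a' p.
- by move=> i; rewrite mnmE; case: (posnP (a i)) => // _; case: eqP.
(* No cover reaches its bound on either side: the total weight is below [m] for [a] and equals m' -
   1 for [a']. *)
- move=> C _; have -> : (m <= \sum_(i in C) (a i).-1)%N = false.
    apply/negbTE; rewrite -ltnNge; apply: leq_ltn_trans Hm.
    by rewrite big_mkcond /=; apply: leq_sum => i _; case: ifP.
  apply/esym/negbTE; rewrite -ltnNge.
  apply: (@leq_ltn_trans (\sum_(i | i == v) m'.-1)%N); last by rewrite big_pred1_eq; lia.
  rewrite big_mkcond [X in (_ <= X)%N]big_mkcond /=; apply: leq_sum => i _.
  by rewrite mnmE; case: ifP => // _; case: ifP => _; case: ifP.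
exists b => //; apply: (@leq_trans (mdeg a' + m)); last by rewrite leq_add2r.
have e1 : (mdeg a' = m'.-1 + \sum_i (0 < a i))%N.
  rewrite mdegE (bigD1 v) //= [in RHS](bigD1 v) //= mnmE av eqxx addnA addn1 prednK //.
  congr addn; apply: eq_bigr => i /negbTE iv; rewrite mnmE iv; by case: posnP.
have e2 : (mdeg a = \sum_i (a i).-1 + \sum_i (0 < a i))%N.
  by rewrite mdegE -big_split; apply: eq_bigr => i _ /=; case: posnP; lia.
rewrite e1 e2; move: Hm; move: (\sum_i (a i).-1)%N (\sum_i (0 < a i))%N => x y; lia.
Qed.

End SymbolicPowerComplexes.

(** * Homogeneous parts of polynomials and of vectors in graded free modules *)

Section Homogeneous.

Variables (K : fieldType) (n : nat).
Local Notation S := {mpoly K[n]}.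
Implicit Types (f g : S) (u w : 'X_{1..n}) (d e : int).

Lemma mcoeffM0 f g z :
  (forall u w, u \in msupp f -> w \in msupp g -> (u + w)%MM <> z) -> (f * g)@_z = 0.
Proof.
move=> h; apply/eqP; rewrite mcoeff_eq0;
  apply/negP => /msuppM_le/allpairsP[[u w] /= [fu gw e]].
exact: h fu gw (esym e).
Qed.

Lemma homog_coeff d f u : homog_of_degree d f -> (mdeg u)%:Z != d -> f@_u = 0.
Proof. by move=> h; apply: contraNeq; rewrite -mcoeff_msupp => /h->. Qed.

Lemma homog_coeffP d f : (forall u, (mdeg u)%:Z != d -> f@_u = 0) -> homog_of_degree d f.
Proof. by move=> h u; rewrite mcoeff_msupp => fu; apply/eqP;
  apply: contraNT fu => /h->. Qed.

Lemma homog0 d : homog_of_degree d (0 : S).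
Proof. by move=> u; rewrite mcoeff_msupp mcoeff0 eqxx. Qed.

Lemma homogD d f g : homog_of_degree d f -> homog_of_degree d g -> homog_of_degree d (f + g).
Proof.
by move=> hf hg; apply: homog_coeffP => u ud;
  rewrite mcoeffD (homog_coeff hf) ?(homog_coeff hg) ?addr0.
Qed.

Lemma homog_sum d (I : Type) (r : seq I) (P : pred I) (F : I -> S) :
  (forall i, P i -> homog_of_degree d (F i)) -> homog_of_degree d (\sum_(i <- r | P i) F i).
Proof. by move=> h; elim/big_ind: _ => //; [exact: homog0 | exact: homogD]. Qed.

Lemma homogN d f : homog_of_degree d f -> homog_of_degree d (- f).
Proof. by move=> hf; apply: homog_coeffP => u ud;
  rewrite mcoeffN (homog_coeff hf) ?oppr0. Qed.

Lemma homogM d e f g : homog_of_degree d f -> homog_of_degree e g -> homog_of_degree (d + e) (f * g).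
Proof.
move=> hf hg u /msuppM_le/allpairsP[[a b] /= [/hf fa /hg gb ->]].
by rewrite mdegD PoszD fa gb.
Qed.

Lemma homogX u : homog_of_degree (mdeg u) ('X_[u] : S).
Proof. by move=> w; rewrite msuppX inE => /eqP->. Qed.

Definition msel (P : pred 'X_{1..n}) f : S :=
  \sum_(u : 'X_{1..n < msize f} | P u) f@_u *: 'X_[u].

Lemma mcoeff_msel P f u : (msel P f)@_u = if P u then f@_u else 0.
Proof.
rewrite /msel raddf_sum big_mkcond /=.
under eq_bigr => v _ do rewrite mcoeffZ mcoeffX.
case: (eqVneq f@_u 0) => [fu0|fu].
  rewrite fu0 if_same big1 // => v _; case: (eqVneq (v : 'X_{1..n}) u) => [->|_].
    by rewrite fu0 mul0r if_same.
  by rewrite mulr0 if_same.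
have ub : (mdeg u < msize f)%N by apply: msize_mdeg_lt; rewrite mcoeff_msupp.
rewrite (bigD1 (BMultinom ub)) //= eqxx mulr1 big1 ?addr0 // => v.
by rewrite bmeqP /= => /negbTE->; rewrite mulr0 if_same.
Qed.

Definition hpart d f : S := msel (fun u => (mdeg u)%:Z == d) f.

Lemma mcoeff_hpart d f u : (hpart d f)@_u = if (mdeg u)%:Z == d then f@_u else 0.
Proof. exact: mcoeff_msel. Qed.

Lemma homog_hpart d f : homog_of_degree d (hpart d f).
Proof. by apply: homog_coeffP => u ud; rewrite mcoeff_hpart (negbTE ud). Qed.

Lemma hpart_id d f : homog_of_degree d f -> hpart d f = f.
Proof.
move=> hf; apply/mpolyP => u; rewrite mcoeff_hpart; case: ifPn => // ud.
by rewrite (homog_coeff hf).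
Qed.

Lemma hpartD d f g : hpart d (f + g) = hpart d f + hpart d g.
Proof. by apply/mpolyP => u; rewrite mcoeffD !mcoeff_hpart mcoeffD; case: ifP;
  rewrite ?addr0. Qed.

Lemma hpart0 d : hpart d 0 = 0.
Proof. by apply/mpolyP => u; rewrite !mcoeff_hpart mcoeff0 if_same. Qed.

Lemma hpart_sum d (I : Type) (r : seq I) (P : pred I) (F : I -> S) :
  hpart d (\sum_(i <- r | P i) F i) = \sum_(i <- r | P i) hpart d (F i).
Proof. by apply: (big_morph (hpart d)); [exact: hpartD | exact: hpart0]. Qed.

Lemma hpartM d e f g : homog_of_degree e g -> hpart d (f * g) = hpart (d - e) f * g.
Proof.
move=> hg; rewrite -[f in LHS](subrK (hpart (d - e) f)) mulrDl hpartD.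
rewrite [X in _ + X]hpart_id; last first.
  by rewrite -[X in homog_of_degree X](subrK e); apply: homogM => //; exact: homog_hpart.
rewrite -[RHS]add0r; congr (_ + _); apply/mpolyP => z; rewrite mcoeff_hpart mcoeff0.
case: eqP => // dz; apply: mcoeffM0 => u w; rewrite mcoeff_msupp mcoeffB mcoeff_hpart.
case: ifPn => [_|/eqP ne _ /hg gw uw]; first by rewrite subrr eqxx.
by apply: ne; rewrite -dz -uw mdegD PoszD gw addrK.
Qed.

Section Vectors.

Variables (r : nat) (deg : 'I_r -> int).
Implicit Types v : 'rV[S]_r.

(** Degree [e] in the twisted free module, the direct sum of the S(-deg b). *)
Definition homog_vec e v := forall b, homog_of_degree (e - deg b) (v 0 b).

Definition vpart e v : 'rV[S]_r := \row_b hpart (e - deg b) (v 0 b).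

Lemma homog_vpart e v : homog_vec e (vpart e v).
Proof. by move=> b; rewrite mxE; exact: homog_hpart. Qed.

Lemma vpart_id e v : homog_vec e v -> vpart e v = v.
Proof. by move=> h; apply/rowP => b; rewrite mxE hpart_id. Qed.

Lemma homog_vec0 e : homog_vec e 0.
Proof. by move=> b; rewrite mxE; exact: homog0. Qed.

Lemma homog_vecD e v (w : 'rV[S]_r) : homog_vec e v -> homog_vec e w -> homog_vec e (v + w).
Proof. by move=> hv hw b; rewrite mxE; apply: homogD. Qed.

Lemma homog_vecN e v : homog_vec e v -> homog_vec e (- v).
Proof. by move=> hv b; rewrite mxE; apply: homogN. Qed.

Lemma homog_vecZ d e f v : homog_of_degree d f -> homog_vec e v -> homog_vec (d + e) (f *: v).
Proof. by move=> hf hv b; rewrite mxE -addrA; apply: homogM. Qed.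

Lemma homog_vec_sum e (I : Type) (s : seq I) (P : pred I) (F : I -> 'rV[S]_r) :
  (forall i, P i -> homog_vec e (F i)) -> homog_vec e (\sum_(i <- s | P i) F i).
Proof. by move=> h; elim/big_ind: _ => //; [exact: homog_vec0 | exact: homog_vecD]. Qed.

(** [B] exceeds the absolute value of every degree occurring in [v]. Degrees can be negative because
    of the twists, hence the shift of the index by [B]. *)
Lemma vpart_total v : exists B : nat, v = \sum_(k < B + B) vpart (k%:Z - B%:Z) v.
Proof.
pose B := (\sum_b (msize (v 0%R b) + `|deg b|))%N; exists B.
apply/rowP => b; apply/mpolyP => u; rewrite summxE raddf_sum /=.
under eq_bigr => k _ do rewrite mxE mcoeff_hpart.
case: (eqVneq ((v 0 b)@_u) 0) => [->|nz]; first by rewrite big1 // => k _; rewrite if_same.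
have uB : (mdeg u + `|deg b| < B)%N.
  rewrite /B (bigD1 b) //=; apply: leq_trans (leq_addr _ _).
  by rewrite ltn_add2r; apply: msize_mdeg_lt; rewrite mcoeff_msupp.
have kB : (absz ((mdeg u)%:Z + deg b + B%:Z)%R < B + B)%N by lia.
rewrite (bigD1 (Ordinal kB)) //= ifT; last by apply/eqP; lia.
rewrite big1 ?addr0 // => k; rewrite -(inj_eq val_inj) /= => nk.
by rewrite ifF //; apply/eqP => h; case/eqP: nk; lia.
Qed.

End Vectors.

Definition graded_mx r' r (deg' : 'I_r' -> int) (deg : 'I_r -> int) (A : 'M[S]_(r', r)) :=
  forall a b, homog_of_degree (deg' a - deg b) (A a b).

Lemma vpart_mulmx r' r (deg' : 'I_r' -> int) (deg : 'I_r -> int) A e v :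
  graded_mx deg' deg A -> vpart deg e (v *m A) = vpart deg' e v *m A.
Proof.
move=> gA; apply/rowP => b; rewrite !mxE hpart_sum; apply: eq_bigr => a _.
by rewrite (hpartM _ _ (gA a b)) mxE; congr (hpart _ _ * _); lia.
Qed.

Lemma homog_mulmx r' r (deg' : 'I_r' -> int) (deg : 'I_r -> int) A e v :
  graded_mx deg' deg A -> homog_vec deg' e v -> homog_vec deg e (v *m A).
Proof. by move=> gA /vpart_id <-; rewrite -(vpart_mulmx _ _ gA); exact: homog_vpart. Qed.

End Homogeneous.

(** * Koszul chains with coefficients in a graded submodule, and their multigraded strands *)

Section KoszulHomology.

Variables (K : fieldType) (n : nat).
Local Notation S := {mpoly K[n]}.
Implicit Types (f g : S) (u a : 'X_{1..n}) (d e : int) (s t : {set 'I_n}).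

Definition kdX r : ({set 'I_n} -> 'rV[S]_r) -> {set 'I_n} -> 'rV[S]_r :=
  kd (fun i => 'X_i : S).

Record submodule r (N : 'rV[S]_r -> Prop) : Prop := Submodule {
  submod0 : N 0;
  submodD : forall v w, N v -> N w -> N (v + w);
  submodZ : forall f v, N v -> N (f *: v) }.

Lemma submodN r (N : 'rV[S]_r -> Prop) v : submodule N -> N v -> N (- v).
Proof. by move=> sN; rewrite -scaleN1r; apply: submodZ. Qed.

Lemma submodB r (N : 'rV[S]_r -> Prop) v w : submodule N -> N v -> N w -> N (v - w).
Proof. by move=> sN Nv Nw; apply: submodD => //; apply: submodN. Qed.

Lemma submod_sum r (N : 'rV[S]_r -> Prop) (I : Type) (l : seq I) (P : pred I) F :
  submodule N -> (forall i, P i -> N (F i)) -> N (\sum_(i <- l | P i) F i).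
Proof. by move=> sN h; elim/big_ind: _ => //; [exact: submod0 | exact: submodD]. Qed.

Lemma submodT r : submodule (fun _ : 'rV[S]_r => True).
Proof. by []. Qed.

(** The basis element e_s has degree |s| = p, which leaves d - p for its coefficient. *)
Definition koszul_chain r (deg : 'I_r -> int) (N : 'rV[S]_r -> Prop) p d c :=
  forall s, [/\ N (c s), homog_vec deg (d - p%:Z) (c s) & #|s| != p -> c s = 0].

(* Vanishing of the degree d part of Tor_p(N, K). *)
Definition koszul_acyclic r (deg : 'I_r -> int) (N : 'rV[S]_r -> Prop) p d :=
  forall c, koszul_chain deg N p d c -> (forall s, kdX c s = 0) ->
  exists2 b, koszul_chain deg N p.+1 d b & forall s, c s = kdX b s.

Lemma koszul_chainB r (deg : 'I_r -> int) N p d c b : submodule N ->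
  koszul_chain deg N p d c -> koszul_chain deg N p d b ->
  koszul_chain deg N p d (fun s => c s - b s).
Proof.
move=> sN hc hb s; have [c1 c2 c3] := hc s; have [b1 b2 b3] := hb s; split.
- exact: submodB.
- by apply: homog_vecD => //; apply: homog_vecN.
- by move=> ns; rewrite c3 // b3 // subr0.
Qed.

Lemma homog_ksign i s : homog_of_degree 0 (ksign S i s).
Proof.
rewrite /ksign -signr_odd; case: odd; rewrite ?expr0 ?expr1 //=; last first.
  by rewrite -mpolyX0 -[X in homog_of_degree X]/(Posz 0) -(@mdeg0 n); exact: homogX.
apply: homogN.
by rewrite -mpolyX0 -[X in homog_of_degree X]/(Posz 0) -(@mdeg0 n); exact: homogX.
Qed.

Lemma koszul_chain_kd r (deg : 'I_r -> int) N p d c : submodule N ->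
  koszul_chain deg N p.+1 d c -> koszul_chain deg N p d (kdX c).
Proof.
move=> sN hc s; split.
- by apply: submod_sum => // i is_; apply: submodZ => //; case: (hc (i |: s)).
- apply: homog_vec_sum => i is_; have [_ h _] := hc (i |: s).
  have -> : d - p%:Z = 0 + (mdeg U_(i) : int) + (d - p.+1%:Z) by rewrite mdeg1; lia.
  by apply: homog_vecZ => //; apply: homogM; [exact: homog_ksign | exact: homogX].
- move=> sp; rewrite /kdX /kd big1 // => i is_; have [_ _ ->] := hc (i |: s).
    by rewrite scaler0.
  by rewrite cardsU1 is_ add1n eqSS.
Qed.

Lemma kdX_mulmx r' r (A : 'M[S]_(r', r)) (c : {set 'I_n} -> 'rV[S]_r') s :
  kdX (fun t => c t *m A) s = kdX c s *m A.
Proof. by rewrite /kdX /kd mulmx_suml; apply: eq_bigr => i _; rewrite scalemxAl. Qed.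

(* [below a s] is the exponent of x^(a - s); the subtraction is truncated. *)
Definition below a s : 'X_{1..n} := [multinom (a i - (i \in s))%N | i < n].
Definition pos_on a s := [forall i in s, (0 < a i)%N].

Lemma pos_onU1 a i s : pos_on a (i |: s) = (0 < a i)%N && pos_on a s.
Proof.
apply/forall_inP/andP => [h|[ai /forall_inP h] k].
  split; first by apply: h; rewrite setU11.
  by apply/forall_inP => k ks; apply: h; rewrite inE ks orbT.
by rewrite !inE => /orP[/eqP->|/h].
Qed.

Lemma belowU1 a i s : i \notin s -> (0 < a i)%N -> (below a (i |: s) + U_(i) = below a s)%MM.
Proof.
move=> is_ ai; apply/mnmP => k; rewrite !mnmE !inE [i == k]eq_sym.
by case: eqP => [->|_] /=; rewrite ?(negbTE is_) ?subn0 ?subnK ?addn0.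
Qed.

Lemma mdeg_below a s : pos_on a s -> (mdeg (below a s) + #|s| = mdeg a)%N.
Proof.
move=> /forall_inP h; rewrite !mdegE -sum1_card [X in (_ + X)%N]big_mkcond -big_split /=.
apply: eq_bigr => i _; rewrite mnmE; case: ifP => [/h|_]; rewrite ?subn0 ?addn0 //.
by move=> ?; rewrite subnK.
Qed.

(** The part of multidegree [a]: e_s has multidegree [s], so its coefficient contributes x^(a - s).
    The test [pos_on] guards against the truncation in [below]; [spread] goes back. *)
Definition strand a (c : {set 'I_n} -> S) s : K^o :=
  if pos_on a s then (c s)@_(below a s) else 0.

Definition spread a (c : {set 'I_n} -> K^o) s : S := (c s : K) *: 'X_[below a s].

Local Notation kdS := (fun (c : {set 'I_n} -> S) s =>
  \sum_(i | i \notin s) (ksign S i s * 'X_i) * c (i |: s)).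
Local Notation kd1 := (@kd n K K^o (fun _ => 1)).

Lemma ksign_mul i s f : ksign S i s * f = ksign K i s *: f.
Proof.
rewrite /ksign -!(signr_odd _ (kpos i s)).
by case: odd; rewrite ?expr0 ?expr1 ?mul1r ?scale1r ?mulN1r ?scaleN1r.
Qed.

(** Multiplication by x_i sends x^(a - s - i) to x^(a - s), so on coefficients the Koszul
    differential becomes the simplicial one. *)
Lemma strand_kd a c s : strand a (kdS c) s = kd1 (strand a c) s.
Proof.
rewrite /strand /kd; case: ifPn => hs; last first.
  by rewrite big1 // => i is_; rewrite pos_onU1 (negbTE hs) andbF scaler0.
rewrite raddf_sum; apply: eq_bigr => i is_ /=.
rewrite -mulrA ksign_mul mcoeffZ mulr1 pos_onU1 hs andbT; congr (_ * _).
case: ifPn => ai; first by rewrite -(belowU1 is_ ai) ['X_i * _]mulrC addmC mcoeffMX.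
apply: mcoeffM0 => u w; rewrite msuppX inE => /eqP-> _ /mnmP/(_ i).
rewrite !mnmE eqxx (negbTE is_) subn0 => h; case/negP: ai; lia.
Qed.

Lemma spread_kd a c s : (forall t, c t != 0 -> pos_on a t) ->
  kdS (spread a c) s = spread a (kd1 c) s.
Proof.
move=> hc; rewrite /spread /kd scaler_suml; apply: eq_bigr => i is_.
rewrite mulr1; case: (eqVneq (c (i |: s)) 0) => [->|/hc];
  first by rewrite scale0r mulr0 scaler0 scale0r.
rewrite pos_onU1 => /andP[ai _]; rewrite -mulrA ksign_mul -scalerAr scalerA; congr (_ *: _).
by rewrite -mpolyXD addmC (belowU1 is_ ai).
Qed.

Lemma kdX_entry r (c : {set 'I_n} -> 'rV[S]_r) b s :
  kdX c s 0 b = kdS (fun t => c t 0 b) s.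
Proof. by rewrite summxE; apply: eq_bigr => i _; rewrite mxE. Qed.

End KoszulHomology.

(** * Koszul homology of monomial modules through simplicial complexes *)

Section MultigradedStrands.

Variables (K : fieldType) (n : nat) (T : 'X_{1..n} -> Prop).
Local Notation S := {mpoly K[n]}.
Implicit Types (f g : S) (u a : 'X_{1..n}) (d : int) (s t : {set 'I_n}).
Local Notation kd1 := (@kd n K K^o (fun _ => 1)).

Definition monomial_module r (v : 'rV[S]_r) := forall b u, u \in msupp (v 0 b) -> T u.

(** The upper Koszul complex in multidegree [a]. *)
Definition cell a s := pos_on a s /\ T (below a s).

Lemma strand_chain r (deg : 'I_r -> int) p d c b a :
  koszul_chain deg (@monomial_module r) p d c ->
  simplicial_chain (cell a) p (strand a (fun s => c s 0 b)).
Proof.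
move=> hc s; have [cT _ c0] := hc s; rewrite /strand /cell; case: ifP => [hs|];
  last by rewrite eqxx.
move=> nz; split; first by split=> //; apply: (cT b); rewrite mcoeff_msupp.
apply/eqP; apply: contraNT nz => /c0->; by rewrite mxE mcoeff0.
Qed.

Definition top s : 'X_{1..n} := [multinom (i \in s : nat) | i < n].

Lemma sum_strands (f : S) (D : nat) s :
  homog_of_degree (D%:Z - #|s|%:Z) f ->
  \sum_(a : 'X_{1..n < D.+1} | mdeg a == D) spread a (strand a (fun _ => f)) s = f.
Proof.
move=> hf; apply/mpolyP => u; rewrite raddf_sum /= big_mkcond /=.
have term a : (spread a (strand a (fun _ => f)) s)@_u =
    if pos_on a s && (below a s == u) then f@_u else 0.
  rewrite /spread /strand mcoeffZ mcoeffX; case: pos_on; rewrite ?mul0r //.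
  by case: eqP => [->|]; rewrite ?mulr1 ?mulr0.
under eq_bigr => a _ do rewrite term.
have aE (a : 'X_{1..n}) : pos_on a s -> below a s = u -> a = (u + top s)%MM.
  move=> /forall_inP hs <-; apply/mnmP => i; rewrite !mnmE;
    case: (boolP (i \in s)) => [/hs|]; lia.
have pu : pos_on (u + top s) s by apply/forall_inP => i is_; rewrite !mnmE is_ addn1.
have bu : below (u + top s) s = u by apply/mnmP => i; rewrite !mnmE addnK.
case: (eqVneq f@_u 0) => [->|fu]; first by rewrite big1 // => a _; rewrite !if_same.
have uD : mdeg (u + top s)%MM = D.
  have := mdeg_below pu; rewrite bu => <-.
  have : (mdeg u)%:Z = D%:Z - #|s|%:Z by apply: hf; rewrite mcoeff_msupp.
  lia.
have ub : (mdeg (u + top s)%MM < D.+1)%N by rewrite uD.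
rewrite (bigD1 (BMultinom ub)) //= uD eqxx pu bu eqxx /= big1 ?addr0 // => a.
rewrite bmeqP /= => /eqP ne; case: ifP => // _; case: ifP => // /andP[h /eqP h'].
by case: ne; apply: aE.
Qed.

(** In component [b] the twist leaves degree d - deg b for the multidegree. If this is negative, the
    bound by [absz] is harmless, as the filter on [mdeg a] empties the sum. *)
Lemma spread_sum_chain r (deg : 'I_r -> int) p d (B : 'I_r -> 'X_{1..n} -> {set 'I_n} -> K^o) :
  (forall b a, (mdeg a)%:Z = d - deg b -> simplicial_chain (cell a) p (B b a)) ->
  koszul_chain deg (@monomial_module r) p d (fun s => \row_b
    \sum_(a : 'X_{1..n < (absz (d - deg b)%R).+1} | (mdeg a)%:Z == d - deg b) spread a (B b a) s).
Proof.
move=> hB.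
have hs b a s u : (mdeg a)%:Z = d - deg b -> u \in msupp (spread a (B b a) s) ->
    [/\ u = below a s, cell a s & #|s| = p].
  move=> da; rewrite mcoeff_msupp mcoeffZ mcoeffX; case: (eqVneq (below a s) u) => [->|];
    last by rewrite mulr0 eqxx.
  by rewrite mulr1 => /(hB _ _ da)[].
move=> s; split.
- move=> b u; rewrite mxE => /msupp_sum_le/flattenP[l /mapP[a]].
  by rewrite mem_filter => /andP[/eqP da _] -> /(hs _ _ _ _ da)[-> []].
- move=> b; rewrite mxE;
    apply: homog_sum => a /eqP da u /(hs _ _ _ _ da)[-> [/mdeg_below h _]].
  by move=> sp; move: h; rewrite sp; lia.
- move=> sp; apply/rowP => b; rewrite !mxE big1 // => a /eqP da.
  apply/mpolyP => u; rewrite mcoeff0; apply/eqP; apply: contraNT sp.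
  by rewrite -mcoeff_msupp => /(hs _ _ _ _ da)[_ _ ->].
Qed.

(** Fillings are chosen strand by strand and added up; in a fixed total degree each component has
    finitely many multidegrees. *)
Lemma boundary_of_strands r (deg : 'I_r -> int) p d c :
  koszul_chain deg (@monomial_module r) p d c ->
  (forall b a, (mdeg a)%:Z = d - deg b -> exists2 e, simplicial_chain (cell a) p.+1 e &
     forall s, strand a (fun t => c t 0 b) s = kd1 e s) ->
  exists2 e, koszul_chain deg (@monomial_module r) p.+1 d e & forall s, c s = kdX e s.
Proof.
move=> hc hB.
pose Bspec b a := fun e => (mdeg a)%:Z = d - deg b -> simplicial_chain (cell a) p.+1 e /\
     forall s, strand a (fun t => c t 0 b) s = kd1 e s.
pose B b a : {set 'I_n} -> K^o := epsilon (inhabits (fun _ => 0 : K^o)) (Bspec b a).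
have BP b a : Bspec b a (B b a).
  apply: epsilon_spec; case: (eqVneq (mdeg a)%:Z (d - deg b)) => [da|/eqP da].
    by have [e e1 e2] := hB b a da; exists e.
  by exists (fun _ => 0).
exists (fun s => \row_b \sum_(a : 'X_{1..n < (absz (d - deg b)%R).+1} | (mdeg a)%:Z == d - deg b)
          spread a (B b a) s).
  by apply: spread_sum_chain => b a da; case: (BP b a da).
move=> s; apply/rowP => b; rewrite kdX_entry /=.
under eq_bigr => i _ do rewrite mxE mulr_sumr.
rewrite exchange_big /=.
transitivity (\sum_(a : 'X_{1..n < (absz (d - deg b)%R).+1} | (mdeg a)%:Z == d - deg b)
   spread a (strand a (fun _ => c s 0 b)) s); last first.
  apply: eq_bigr => a /eqP da; have [B1 B2] := BP b a da.
  rewrite (spread_kd (c := B b a)); last by move=> t /B1[[]].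
  by rewrite /spread -B2.
have [_ h h0] := hc s; case: (eqVneq #|s| p) => [sp|/h0 ->]; last first.
  rewrite !mxE big1 // => a _; rewrite /spread /strand mcoeff0 if_same scale0r //.
case: (lerP 0 (d - deg b)) => hd.
  have dE : d - deg b = (absz (d - deg b))%:Z by rewrite gez0_abs.
  rewrite (eq_bigl (fun a : 'X_{1..n < (absz (d - deg b)%R).+1} => mdeg a == absz (d - deg b)%R)); last first.
    by move=> a; rewrite {2}dE.
  rewrite sum_strands //; have := h b; rewrite sp; congr homog_of_degree; lia.
rewrite big1 => [|a /eqP]; last by lia.
apply/mpolyP => u; rewrite mcoeff0; apply: (homog_coeff (h b)); lia.
Qed.

Lemma koszul_acyclic_strands r (deg : 'I_r -> int) p d :
  (forall b a, (mdeg a)%:Z = d - deg b -> @simplicial_acyclic n K K^o (cell a) p) ->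
  koszul_acyclic deg (@monomial_module r) p d.
Proof.
move=> hac c hc dc; apply: boundary_of_strands => // b a da.
apply: hac da _ _ _; first exact: strand_chain hc.
by move=> s; rewrite -strand_kd /strand -kdX_entry dc mxE mcoeff0 if_same.
Qed.

(** A simplicial cycle spreads to a Koszul cycle; the strand of a filling of the latter fills the
    former. *)
Lemma strands_koszul_acyclic p a :
  koszul_acyclic (fun _ : 'I_1 => 0) (@monomial_module 1) p (mdeg a) ->
  @simplicial_acyclic n K K^o (cell a) p.
Proof.
move=> hac c hc dc.
have [e he ce] : exists2 e, koszul_chain (fun _ : 'I_1 => 0) (@monomial_module 1) p.+1 (mdeg a) e
      & forall s, \row_b spread a c s = kdX e s.
  apply: hac => s.
    case: (eqVneq (c s) 0) => [cs|/hc[[cs Ts] sp]].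
      have -> : \row_b0 spread a c s = 0 :> 'rV[S]_1 by apply/rowP => b;
        rewrite !mxE /spread cs scale0r.
      by split=> //; [move=> b u; rewrite mxE msupp0 | exact: homog_vec0].
    split.
    - by move=> b u; rewrite mxE => /msuppZ_le; rewrite msuppX inE => /eqP->.
    - move=> b u; rewrite mxE => /msuppZ_le; rewrite msuppX inE => /eqP->.
      by have := mdeg_below cs; rewrite sp; lia.
    - by rewrite sp eqxx.
  apply/rowP => b; rewrite kdX_entry mxE.
  under eq_bigr => i _ do rewrite mxE.
  by rewrite spread_kd => [|t /hc[[]]] //; rewrite /spread dc scale0r.
exists (strand a (fun s => e s 0 0)); first exact: strand_chain he.
move=> s; rewrite -strand_kd /strand -kdX_entry -ce mxE.
rewrite /spread mcoeffZ mcoeffX eqxx mulr1; case: ifP => // /negP h.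
by apply/eqP; apply: contra_notT h => /hc[[]].
Qed.

End MultigradedStrands.

(** * Free modules, dimension shifting and generators *)

Section Syzygies.

Variables (K : fieldType) (n : nat).
Local Notation S := {mpoly K[n]}.
Implicit Types (d : int) (s : {set 'I_n}).

Lemma sub_koszul_chain r (deg : 'I_r -> int) (N N' : 'rV[S]_r -> Prop) p d c :
  (forall v, N v -> N' v) -> koszul_chain deg N p d c -> koszul_chain deg N' p d c.
Proof. by move=> NN' hc s; have [c1 c2 c3] := hc s; split=> //; apply: NN'. Qed.

Lemma cell_true_acyclic (R : comNzRingType) (V : lmodType R) (a : 'X_{1..n}) v p :
  (0 < a v)%N -> @simplicial_acyclic n R V (cell (fun _ => True) a) p.
Proof.
move=> av; apply: (@simplicial_acyclic_cone _ _ _ _ v) => s [hs _].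
by split=> //; rewrite pos_onU1 av.
Qed.

(** Exactness of the Koszul complex of a free module: a strand of nonzero multidegree is a cone, and
    multidegree 0 has only the empty face, carrying a constant term in homological degree 0. *)
Lemma free_boundary r (deg : 'I_r -> int) p d c :
  koszul_chain deg (fun _ : 'rV[S]_r => True) p d c -> (forall s, kdX c s = 0) ->
  (p = 0%N -> forall b, (c set0 0 b)@_0 = 0) ->
  exists2 e, koszul_chain deg (fun _ : 'rV[S]_r => True) p.+1 d e & forall s, c s = kdX e s.
Proof.
move=> hc dc c0.
have hc' : koszul_chain deg (@monomial_module K n (fun _ => True) r) p d c.
  exact: sub_koszul_chain hc.
have [|e he ce] := boundary_of_strands hc'; last by exists e => //;
  apply: sub_koszul_chain he.
move=> b a da; case: (pickP (fun v => 0 < a v)%N) => [v av|a0].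
  apply: (cell_true_acyclic av); first exact: strand_chain hc'.
  by move=> s; rewrite -strand_kd /strand -kdX_entry dc mxE mcoeff0 if_same.
exists (fun _ => 0) => s; first by rewrite eqxx.
rewrite kd0; case: (eqVneq (strand a (fun t => c t 0 b) s) 0) => // nz; exfalso.
have [[/forall_inP ps _] sp] := strand_chain hc' nz.
have s0 : s = set0 by apply/setP => i; rewrite inE; apply/negP => /ps; rewrite a0.
move: nz; rewrite /strand s0; case: ifP => _; last by rewrite eqxx.
have -> : below a set0 = 0%MM.
  by apply/mnmP => i; rewrite !mnmE; have := a0 i; case: (a i).
by rewrite c0 ?eqxx // -sp s0 cards0.
Qed.

Section Presentation.

Variables (r' r : nat) (deg' : 'I_r' -> int) (deg : 'I_r -> int) (A : 'M[S]_(r', r)).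
Hypothesis gA : graded_mx deg' deg A.

Definition row_module (v : 'rV[S]_r) := exists w : 'rV_r', v = w *m A.
Definition ker_module (w : 'rV[S]_r') := w *m A = 0.

Lemma row_submodule : submodule row_module.
Proof.
split=> [|v w [v' ->] [w' ->]|f v [v' ->]].
- by exists 0; rewrite mul0mx.
- by exists (v' + w'); rewrite mulmxDl.
- by exists (f *: v'); rewrite scalemxAl.
Qed.

Lemma ker_submodule : submodule ker_module.
Proof.
split=> [|v w v0 w0|f v v0].
- exact: mul0mx.
- by rewrite /ker_module mulmxDl v0 w0 addr0.
- by rewrite /ker_module -scalemxAl v0 scaler0.
Qed.

Lemma koszul_chain_lift p d c : koszul_chain deg row_module p d c ->
  exists2 c', koszul_chain deg' (fun _ => True) p d c' & forall s, c s = c' s *m A.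
Proof.
move=> hc; pose lift s := epsilon (inhabits 0) (fun w => c s = w *m A).
have liftP s : c s = lift s *m A.
  by case: (hc s) => h _ _; exact: (epsilon_spec (inhabits 0) (fun w => c s = w *m A) h).
exists (fun s => if #|s| == p then vpart deg' (d - p%:Z) (lift s) else 0) => s.
  split=> // [|/negbTE->//]; case: eqP => _; [exact: homog_vpart | exact: homog_vec0].
have [_ h h0] := hc s; case: (eqVneq #|s| p) => [_|/h0->]; last by rewrite mul0mx.
by rewrite -(vpart_mulmx _ _ gA) -liftP vpart_id.
Qed.

Lemma koszul_chain_push p d c : koszul_chain deg' (fun _ => True) p d c ->
  koszul_chain deg row_module p d (fun s => c s *m A).
Proof.
move=> hc s; have [_ h h0] := hc s; split; first by exists (c s).
  exact: homog_mulmx gA h.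
by move/h0->; rewrite mul0mx.
Qed.

(** Diagram chase along 0 -> ker -> F' -> im -> 0: the boundary of a lift [c'] is a cycle in the
    kernel, hence the boundary of some [b] there, and [c' - b] bounds in the free module. *)
Lemma koszul_acyclic_syzygy_up p d :
  koszul_acyclic deg' ker_module p d -> koszul_acyclic deg row_module p.+1 d.
Proof.
move=> hac c hc dc; have [c' hc' cc'] := koszul_chain_lift hc.
have [||b hb db] := hac (kdX c').
- move=> s; have [_ h1 h2] := koszul_chain_kd (@submodT _ _ _) hc' s; split=> //.
  by rewrite /ker_module -kdX_mulmx -(dc s); apply: eq_kd => t; rewrite cc'.
- by move=> s; exact: kd_kd.
have [||//|e he ce] := @free_boundary _ deg' p.+1 d (fun s => c' s - b s).
- by apply: koszul_chainB => //; apply: sub_koszul_chain hb.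
- by move=> s; rewrite /kdX kdB -/(kdX c' s) db subrr.
exists (fun s => e s *m A); first exact: koszul_chain_push.
move=> s; rewrite kdX_mulmx -ce mulmxBl -cc'.
by have [-> _ _] := hb s; rewrite subr0.
Qed.

Definition minimal_rows := forall w, ker_module w -> forall b, (w 0 b)@_0 = 0.

(** Minimality matters at [p = 0]: elements of the kernel have no constant terms, so they bound in
    the free module. *)
Lemma koszul_acyclic_syzygy_down p d : minimal_rows ->
  koszul_acyclic deg row_module p.+1 d -> koszul_acyclic deg' ker_module p d.
Proof.
move=> mA hac c hc dc.
have [|||e he ce] := @free_boundary _ deg' p d c.
- exact: sub_koszul_chain hc.
- exact: dc.
- by move=> _ b; case: (hc set0) => /mA.
have [||b hb eb] := hac (fun s => e s *m A).
- exact: koszul_chain_push.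
- by move=> s; rewrite kdX_mulmx -ce; case: (hc s).
have [b' hb' bb'] := koszul_chain_lift hb.
(* [e] and [kdX b'] have the same image under [A], so the difference lies in the kernel, and its
   boundary is still [c]. *)
exists (fun s => e s - kdX b' s); last by move=> s; rewrite /kdX kdB kd_kd subr0.
move=> s; have [_ h1 h2] := koszul_chainB (@submodT _ _ _) he (koszul_chain_kd (@submodT _ _ _) hb') s.
split=> //; rewrite /ker_module mulmxBl eb -kdX_mulmx.
by apply/eqP; rewrite subr_eq0; apply/eqP; apply: eq_kd.
Qed.

(** The rows of [A] give a basis of Tor_0. If row [a] were a boundary, the basis vector at [a] minus
    a boundary would be a relation with constant term 1. If no row has degree [d], a lift in degree
    [d] has no constant terms and so bounds. *)
Lemma koszul_acyclic0_degrees d : minimal_rows ->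
  koszul_acyclic deg row_module 0 d <-> (forall a, deg' a <> d).
Proof.
move=> mA; split=> [hac a da|hd c hc dc].
  pose c s := if s == set0 then row a A else 0.
  have [||b hb cb] := hac c.
  - move=> s; rewrite /c -cards_eq0; split=> [||/negbTE->//]; case: eqP => _.
    + by exists (delta_mx 0 a); rewrite -rowE.
    + exact: submod0 row_submodule.
    + by move=> b; rewrite mxE subr0 -da.
    + exact: homog_vec0.
  - move=> s; rewrite /kdX /kd big1 // => i is_.
    rewrite /c ifF ?scaler0 //; apply/negbTE/set0Pn; exists i; exact: setU11.
  have [b' hb' bb'] := koszul_chain_lift hb.
  have k : ker_module (delta_mx 0 a - kdX b' set0).
    rewrite /ker_module mulmxBl -rowE -kdX_mulmx; apply/eqP; rewrite subr_eq0; apply/eqP.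
    transitivity (c set0); first by rewrite /c eqxx.
    by rewrite cb; apply: eq_kd.
  have := mA _ k a; rewrite mxE mcoeffD [X in X@_ _ + _]mxE !eqxx mcoeff1 eqxx.
  rewrite [X in _ + X@_ _]mxE mcoeffN kdX_entry raddf_sum big1 ?subr0 /= => [/eqP|i _];
    first by rewrite oner_eq0.
  rewrite -mulrA ksign_mul mcoeffZ mcoeffM0 ?mulr0 // => u w.
  by rewrite msuppX inE => /eqP-> _ /mnmP/(_ i); rewrite !mnmE eqxx.
have [c' hc' cc'] := koszul_chain_lift hc.
have [|_ b|e he ce] := free_boundary hc'.
- move=> s; rewrite /kdX /kd big1 // => i is_; have [_ _ ->] := hc' (i |: s).
    by rewrite scaler0.
  by rewrite cardsU1 is_.
- have [_ h _] := hc' set0; apply: homog_coeff (h b) _; rewrite mdeg0 subr0.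
  by rewrite eq_sym subr_eq0; apply/eqP => /esym/hd.
exists (fun s => e s *m A); first exact: koszul_chain_push.
by move=> s; rewrite kdX_mulmx -ce.
Qed.

End Presentation.

End Syzygies.

(** * Extremal choices and linear subspaces given by predicates *)

Lemma ex_max_nat (P : nat -> Prop) b : (exists k, P k) -> (forall k, P k -> (k <= b)%N) ->
  exists2 k, P k & forall l, P l -> (l <= k)%N.
Proof.
move=> [k0 Pk0] Pb; have [j] := ubnP (b - k0).
elim: j k0 Pk0 => // j IH k0 Pk0 lej.
case: (classic (exists2 l, P l & (k0 < l)%N)) => [[l Pl kl]|h].
  by apply: (IH l) => //; have := Pb l Pl; lia.
by exists k0 => // l Pl; rewrite leqNgt; apply/negP => kl; apply: h; exists l.
Qed.

Lemma ex_min_nat (P : nat -> Prop) : (exists k, P k) ->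
  exists2 k, P k & forall l, P l -> (k <= l)%N.
Proof.
move=> [k0]; elim/ltn_ind: k0 => k IH Pk.
case: (classic (exists2 l, P l & (l < k)%N)) => [[l Pl kl]|h]; first exact: IH Pl.
by exists k => // l Pl; rewrite leqNgt; apply/negP => kl; apply: h; exists l.
Qed.

(** [M] has maximal rank among the matrices with row space inside [Q]; a vector of [Q] outside that
    row space would raise the rank. *)
Lemma row_subspace (K : fieldType) N (Q : 'rV[K]_N -> Prop) :
  Q 0 -> (forall a x y, Q x -> Q y -> Q (a *: x + y)) ->
  exists M : 'M[K]_N, forall x, Q x <-> (x <= M)%MS.
Proof.
move=> Q0 QD.
pose P k := exists2 M : 'M[K]_N, (forall x, (x <= M)%MS -> Q x) & \rank M = k.
have [|k [M QM <-]|k [M QM rM] kmax] := @ex_max_nat P N.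
- by exists 0%N, 0; [move=> x; rewrite submx0 => /eqP-> | rewrite mxrank0].
- exact: rank_leq_row.
exists M => x; split=> [Qx|/QM //]; apply: contraT => xM.
have : (\rank (M + x)%MS <= k)%N.
  apply: kmax; exists (M + x)%MS => // y /sub_addsmxP[[u1 u2] /= ->].
  rewrite addrC [u2](mx11_scalar) mul_scalar_mx; apply: QD => //.
  by apply: QM; exact: submxMl.
rewrite -rM leqNgt; suff -> : (\rank M < \rank (M + x)%MS)%N by [].
apply: rank_ltmx; rewrite /ltmx addsmxSl /=; apply: contraNN xM.
by apply: submx_trans; exact: addsmxSr.
Qed.

(** * Finite generation and minimal presentations of graded submodules *)

Section FiniteGeneration.

Variables (K : fieldType) (n r : nat) (deg : 'I_r -> int).
Local Notation S := {mpoly K[n]}.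
Implicit Types (d e : int) (s : {set 'I_n}).
Variable N : 'rV[S]_r -> Prop.
Hypotheses (sN : submodule N) (hN : forall e v, N v -> N (vpart deg e v)).

(** A single degree of the free module is finite-dimensional over [K]: [psi] sends coefficient
    vectors onto a space containing it, so [row_subspace] applies. Generation is tested against all
    submodules [W]. *)
Lemma homog_span e : exists2 l : seq 'rV[S]_r,
  (forall v, v \in l -> N v /\ homog_vec deg e v) &
  forall W, submodule W -> (forall v, v \in l -> W v) ->
    forall v, N v -> homog_vec deg e v -> W v.
Proof.
pose B := (`|e| + \sum_b `|deg b|)%N.
pose I := ('I_r * 'X_{1..n < B.+1})%type.
pose psi (x : 'rV[K]_#|{: I}|) : 'rV[S]_r :=
  \row_b \sum_(u : 'X_{1..n < B.+1}) x 0 (enum_rank (b, u)) *: 'X_[u].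
have psiL a x y : psi (a *: x + y) = a%:MP *: psi x + psi y.
  apply/rowP => b; rewrite !mxE mulr_sumr -big_split; apply: eq_bigr => u _ /=.
  by rewrite !mxE mul_mpolyC scalerDl scalerA.
have psi0 : psi 0 = 0 by apply/rowP => b; rewrite !mxE big1 // => u _; rewrite mxE scale0r.
have psiK v : homog_vec deg e v -> exists x, psi x = v.
  move=> hv; exists (\row_(k < #|{: I}|) (v 0 (enum_val k : I).1)@_(enum_val k : I).2).
  apply/rowP => b; rewrite mxE [RHS](@mpolywE _ _ B.+1 (v 0 b)); last first.
    rewrite msizeE; apply/bigmax_leqP_seq => u /hv ud _; rewrite ltnS /B (bigD1 b) //=.
    by rewrite addnA; apply: leq_trans (leq_addr _ _); lia.
  by apply: eq_bigr => u _; rewrite mxE enum_rankK.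
have [||M QM] := @row_subspace K _ (fun x => N (psi x) /\ homog_vec deg e (psi x)).
- by rewrite psi0; split; [exact: submod0 | exact: homog_vec0].
- move=> a x y [Nx hx] [Ny hy]; rewrite psiL; split.
    by apply: submodD => //; exact: submodZ.
  apply: homog_vecD => //; rewrite -[e]add0r; apply: homog_vecZ => //.
  by move=> u; rewrite msuppC; case: eqP => //= _; rewrite inE => /eqP->; rewrite mdeg0.
exists [seq psi (row i M) | i <- enum 'I_#|{: I}|].
  by move=> v /mapP[i _ ->]; apply/QM; exact: row_sub.
move=> W sW Wl v Nv hv; have [x xv] := psiK _ hv.
have /submxP[D xD] : (x <= M)%MS by apply/QM; rewrite xv.
rewrite -xv xD mulmx_sum_row.
apply: (big_ind (fun x => W (psi x))) => [|y z Wy Wz|i _].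
- by rewrite psi0; exact: submod0.
- by rewrite -[y]scale1r psiL mpolyC1 scale1r; exact: submodD.
- rewrite -[_ *: _]addr0 psiL psi0 addr0; apply: submodZ => //.
  by apply: Wl; apply/mapP; exists i => //; rewrite mem_enum.
Qed.

Definition generates (l : seq (int * 'rV[S]_r)) :=
  (forall x, x \in l -> N x.2 /\ homog_vec deg x.1 x.2) /\
  (forall W, submodule W -> (forall x, x \in l -> W x.2) -> forall v, N v -> W v).

Variable D : int.
Hypothesis acD : forall d, D < d -> koszul_acyclic deg N 0 d.

(** Above [D] Tor_0 vanishes, so every element is a combination of products of x_i with elements of
    one degree less; below [-L] there is nothing. The finitely many degrees in between are handled
    by [homog_span]. *)
Lemma finitely_generated : exists l, generates l.
Proof.
pose L := (\sum_b `|deg b|)%N.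
have [G G1 G2] : exists2 G : int -> seq 'rV[S]_r,
    (forall e v, v \in G e -> N v /\ homog_vec deg e v) &
    (forall e W, submodule W -> (forall v, v \in G e -> W v) ->
      forall v, N v -> homog_vec deg e v -> W v).
  pose G e := epsilon (inhabits [::]) (fun l => 
   (forall v, v \in l -> N v /\ homog_vec deg e v) /\
    forall W, submodule W -> (forall v, v \in l -> W v) ->
    forall v, N v -> homog_vec deg e v -> W v).
  have GP e := epsilon_spec (inhabits [::]) (fun l => 
   (forall v, v \in l -> N v /\ homog_vec deg e v) /\
    forall W, submodule W -> (forall v, v \in l -> W v) ->
    forall v, N v -> homog_vec deg e v -> W v).
  have GP' e := GP e (let: ex_intro2 l l1 l2 := homog_span e in ex_intro _ l (conj l1 l2)).
  by exists G => e; case: (GP' e).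
pose q := (`|D| + L).+1.
exists (flatten [seq [seq (k%:Z - L%:Z, v) | v <- G (k%:Z - L%:Z)] | k <- iota 0 q]); split.
  by move=> x /flatten_mapP[k _ /mapP[v /G1 [Nv hv] ->]].
move=> W sW Wl.
have Wh k v : N v -> homog_vec deg (k%:Z - L%:Z) v -> W v.
  elim: k v => [|k IH] v Nv hv.
    apply: (G2 (0%:Z - L%:Z)) => // w wG; apply: (Wl (0%:Z - L%:Z, w));
      apply/flatten_mapP; exists 0%N => //.
    by apply/mapP; exists w.
  case: (ltnP k.+1 q) => kq.
    apply: (G2 (k.+1%:Z - L%:Z)) => // w wG; apply: (Wl (k.+1%:Z - L%:Z, w));
      apply/flatten_mapP.
    by exists k.+1; rewrite ?mem_iota //; apply/mapP; exists w.
  have Dk : D < k.+1%:Z - L%:Z by lia.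
  pose c s := if s == set0 then v else 0.
  have [||b hb cb] := acD Dk (c := c).
  - move=> s; rewrite /c -cards_eq0; split=> [||/negbTE->//]; case: eqP => _ //.
    + exact: submod0.
    + by rewrite subr0.
    + exact: homog_vec0.
  - move=> s; rewrite /kdX /kd big1 // => i is_.
    rewrite /c ifF ?scaler0 //; apply/negbTE/set0Pn; exists i; exact: setU11.
  have -> : v = kdX b set0 by rewrite -cb /c eqxx.
  apply: submod_sum => // i _; apply: submodZ => //.
  have [Nb hbi _] := hb (i |: set0); apply: IH => //.
  by have -> : k%:Z - L%:Z = k.+1%:Z - L%:Z - 1%:Z by lia.
move=> v Nv; have [B ->] := vpart_total deg v.
apply: submod_sum => // k _; case: (lerP (- L%:Z) (k%:Z - B%:Z)) => hk.
  apply: (Wh (absz (k%:Z - B%:Z + L%:Z))); first exact: hN.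
  by rewrite gez0_abs ?addrK; [exact: homog_vpart | lia].
suff -> : vpart deg (k%:Z - B%:Z) v = 0 by exact: submod0.
apply/rowP => b; rewrite !mxE; apply/mpolyP => u; rewrite mcoeff_hpart mcoeff0 ifF //.
apply/negbTE/eqP => hu.
have : (`|deg b| <= L)%N by rewrite /L (bigD1 b) //= leq_addr.
lia.
Qed.

(** The rows form a shortest homogeneous generating list: a relation with a nonzero constant term at
    [a] would express generator [a] through the others. *)
Lemma minimal_presentation : exists r' (deg' : 'I_r' -> int) (A : 'M[S]_(r', r)),
  [/\ graded_mx deg' deg A, forall v, N v <-> row_module A v & minimal_rows A].
Proof.
have [m [l gl <-] lmin] : exists2 m, (exists2 l, generates l & size l = m) &
    forall m', (exists2 l, generates l & size l = m') -> (m <= m')%N.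
  by apply: ex_min_nat; have [l gl] := finitely_generated; exists (size l), l.
have [l1 l2] := gl.
pose x (a : 'I_(size l)) := nth (0, 0) l a.
have xl a : x a \in l by exact: mem_nth.
pose A : 'M[S]_(size l, r) := \matrix_(a, b) (x a).2 0 b.
have rowA a : row a A = (x a).2 by apply/rowP => b; rewrite !mxE.
have gA : graded_mx (fun a => (x a).1) deg A.
  by move=> a b; rewrite mxE; case: (l1 _ (xl a)) => _; exact.
exists (size l), (fun a => (x a).1), A; split=> //.
  move=> v; split=> [|[w ->]].
    apply: l2 => [|y /(nthP (0, 0))[a al <-]]; first exact: row_submodule.
    by exists (delta_mx 0 (Ordinal al)); rewrite -rowE rowA.
  rewrite mulmx_sum_row; apply: submod_sum => // a _; apply: submodZ => //.
  by rewrite rowA; case: (l1 _ (xl a)).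
move=> w wA a; apply/eqP; apply: contraT => wa; exfalso.
(* The part in the degree of generator [a] is still a relation, and its entry at [a] is exactly the
   nonzero constant, which is invertible. *)
pose w' := vpart (fun a => (x a).1) (x a).1 w.
have w'A : w' *m A = 0.
  by rewrite -(vpart_mulmx _ _ gA) wA; apply/rowP => b; rewrite !mxE hpart0.
have w'a : w' 0 a = ((w 0 a)@_0)%:MP.
  apply/mpolyP => u; rewrite mxE mcoeff_hpart mcoeffC subrr.
  have -> : ((mdeg u)%:Z == 0) = (u == 0%MM) by rewrite -mdeg_eq0.
  case: eqP => [->|_]; rewrite ?mulr1 ?mulr0 //.
pose l' := [seq x b | b <- enum (predC1 a)].
have gl' : generates l'.
  split=> [y /mapP[b _ ->]|W sW Wl']; first exact: l1.
  apply: l2 => // y /(nthP (0, 0))[b bl <-].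
  rewrite -[nth _ _ _]/(x (Ordinal bl)); move: (Ordinal bl) => c0.
  have Wb c : c != a -> W (x c).2.
    by move=> ca; apply: Wl'; apply: map_f; rewrite mem_enum.
  case: (eqVneq c0 a) => [->|/Wb //].
  have -> : (x a).2 = (- ((w 0 a)@_0)^-1)%:MP *: \sum_(c | c != a) w' 0 c *: (x c).2.
    have := w'A; rewrite mulmx_sum_row (bigD1 a) //= rowA w'a => /eqP.
    under eq_bigr => c _ do rewrite rowA.
    rewrite addrC addr_eq0 => /eqP->; rewrite scalerN scalerA -mpolyCM mulNr mulVf //.
    by rewrite mpolyCN mpolyC1 scaleN1r opprK.
  apply: submodZ => //; apply: submod_sum => // c ca; apply: submodZ => //; exact: Wb.
have := lmin (size l') (ex_intro2 _ _ l' gl' erefl).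
by rewrite size_map -cardE cardC1 card_ord; case: (size l) (a) => [[]|k _] //; rewrite ltnn.
Qed.

End FiniteGeneration.

(** * Minimal resolutions, Betti numbers and regularity *)

Section Regularity.

Variables (K : fieldType) (n : nat).
Local Notation S := {mpoly K[n]}.
Implicit Types (d e : int) (J : S -> Prop).

Lemma eq_koszul_acyclic r (deg : 'I_r -> int) (N N' : 'rV[S]_r -> Prop) p d :
  (forall v, N v <-> N' v) -> koszul_acyclic deg N p d -> koszul_acyclic deg N' p d.
Proof.
move=> NN' h c hc dc; have [||b hb cb] := h c => //.
  by apply: sub_koszul_chain hc => v /NN'.
by exists b => //; apply: sub_koszul_chain hb => v /NN'.
Qed.

(** A syzygy module with what is needed to present it. The bound holds for all [p] and passes
    unchanged to the next stage, since dimension shifting changes only [p]. *)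
Record stage (D : int) := Stage {
  stage_rank : nat;
  stage_deg : 'I_stage_rank -> int;
  stage_mod : 'rV[S]_stage_rank -> Prop;
  stage_sub : submodule stage_mod;
  stage_graded : forall e v, stage_mod v -> stage_mod (vpart stage_deg e v);
  stage_bound : forall p d, D < d -> koszul_acyclic stage_deg stage_mod p d }.

Lemma ker_graded r' r (deg' : 'I_r' -> int) (deg : 'I_r -> int) (A : 'M[S]_(r', r)) e v :
  graded_mx deg' deg A -> ker_module A v -> ker_module A (vpart deg' e v).
Proof.
move=> gA vA; rewrite /ker_module -(vpart_mulmx _ _ gA) vA.
by apply/rowP => b; rewrite !mxE hpart0.
Qed.

Lemma next_stage D (s : stage D) :
  exists (t : stage D) (A : 'M[S]_(stage_rank t, stage_rank s)),
  [/\ graded_mx (@stage_deg _ t) (@stage_deg _ s) A,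
      forall v, stage_mod v <-> row_module A v,
      minimal_rows A & forall w, stage_mod w <-> ker_module A w].
Proof.
case: s => r deg N sN hN bN.
have [r' [deg' [A [gA NA mA]]]] := minimal_presentation sN hN (bN 0%N).
have bA p d : D < d -> koszul_acyclic deg' (ker_module A) p d.
  by move=> Dd; apply: (koszul_acyclic_syzygy_down gA mA);
    apply: eq_koszul_acyclic (bN _ _ Dd).
exists (@Stage D r' deg' (ker_module A) (ker_submodule A) (fun e v => @ker_graded _ _ _ _ _ e v gA) bA).
by exists A.
Qed.

Definition ideal_module J (v : 'rV[S]_1) := J (v 0 0).

Lemma min_res_exists J D : submodule (ideal_module J) ->
  (forall e v, ideal_module J v -> ideal_module J (vpart (fun _ : 'I_1 => 0) e v)) ->
  (forall p d, D < d -> koszul_acyclic (fun _ : 'I_1 => 0) (ideal_module J) p d) ->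
  exists F, minimal_graded_free_resolution J F.
Proof.
move=> sJ gJ bJ; pose st0 := Stage sJ gJ bJ.
pose next (s : stage D) := constructive_indefinite_description _ (next_stage s).
pose st := fix st i := if i is i'.+1 then sval (next (st i')) else st0.
pose A i := sval (constructive_indefinite_description _ (svalP (next (st i)))).
have AP i := svalP (constructive_indefinite_description _ (svalP (next (st i)))).
(* Stage 0 is the ideal inside S^1, so F_i has the rank of stage i+1, and the presentation of stage
   0 is the augmentation. *)
exists (@FreeRes K n (fun i => stage_rank (st i.+1)) (fun i => @stage_deg _ (st i.+1))
   (A 0%N) (fun i => A i.+1)); split.
- split=> [a|i a b] /=; last by case: (AP i.+1).
  by case: (AP 0%N) => gA _ _ _; have := gA a 0; rewrite subr0.
- split=> [f|v|i v] /=.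
  + case: (AP 0%N) => _ /= h _ _; have := h (const_mx f); rewrite /ideal_module mxE => ->.
    split=> -[w e]; exists w; first by rewrite -e mxE.
    by apply/rowP => b; rewrite !ord1 mxE.
  + case: (AP 0%N) => _ _ _ h; rewrite -[_ = 0]/(ker_module (A 0%N) v) -h.
    by case: (AP 1%N) => _ /(_ v).
  + case: (AP i.+1) => _ _ _ h; rewrite -[_ = 0]/(ker_module (A i.+1) v) -h.
    by case: (AP i.+2) => _ /(_ v).
- move=> i a b /=; case: (AP i) => _ _ mA h.
  (* Rows of the next presentation are relations of this one, and those have no constant terms. *)
  have : ker_module (A i) (row a (A i.+1)).
    by apply/h; case: (AP i.+1) => _ hh _ _; apply/hh; exists (delta_mx 0 a); rewrite -rowE.
  by move/mA => /(_ b); rewrite mxE.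
Qed.

Section Resolution.

Variables (J : S -> Prop) (F : free_res K n).
Hypothesis FJ : minimal_graded_free_resolution J F.

Let gaug : graded_mx (@res_deg _ _ F 0) (fun _ : 'I_1 => 0) (res_aug F).
Proof. by move=> a b; rewrite subr0 ord1; case: FJ => -[h _] _ _; exact: h. Qed.

Let gdif i : graded_mx (@res_deg _ _ F i.+1) (@res_deg _ _ F i) (res_dif F i).
Proof. by case: FJ => -[_ h] _ _; exact: h. Qed.

Let minimal_image i (w : 'rV[S]_(res_rank F i.+1)) b : ((w *m res_dif F i) 0 b)@_0 = 0.
Proof.
rewrite mxE raddf_sum big1 //= => a _; rewrite rmorphM /=.
by case: FJ => _ _ mF; rewrite mF mulr0.
Qed.

Let maug : minimal_rows (res_aug F).
Proof. by move=> w; case: FJ => _ [_ h _] _ /h[w' ->] b; exact: minimal_image. Qed.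

Let mdif i : minimal_rows (res_dif F i).
Proof. by move=> w; case: FJ => _ [_ _ h] _ /h[w' ->] b; exact: minimal_image. Qed.

Let row_aug v : ideal_module J v <-> row_module (res_aug F) v.
Proof.
case: FJ => _ [h _ _] _; rewrite /ideal_module h; split=> -[w e]; exists w;
  last by rewrite e.
by apply/rowP => b; rewrite !ord1.
Qed.

Let syz i : 'rV[S]_(res_rank F i) -> Prop :=
  if i is i'.+1 then ker_module (res_dif F i') else ker_module (res_aug F).

Let row_dif i v : @syz i v <-> row_module (res_dif F i) v.
Proof. by case: i v => [|i] v; case: FJ => _ [_ h1 h2] _; [exact: h1 | exact: h2]. Qed.

(** Iterated dimension shifting: [syz i] is the (i+1)-st syzygy module of [J], inside F_i. *)
Lemma koszul_acyclic_syz i p d :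
  koszul_acyclic (@res_deg _ _ F i) (@syz i) p d <->
  koszul_acyclic (fun _ : 'I_1 => 0) (ideal_module J) (i.+1 + p) d.
Proof.
elim: i p => [|i IH] p; rewrite ?addSn ?add0n.
  split=> h; first by apply: eq_koszul_acyclic (koszul_acyclic_syzygy_up gaug h) => v;
    rewrite row_aug.
  apply: (koszul_acyclic_syzygy_down gaug maug).
  by apply: eq_koszul_acyclic h => v; rewrite row_aug.
rewrite -[in X in _ <-> koszul_acyclic _ _ X _]addnS -addSn -IH.
split=> h; first by apply: eq_koszul_acyclic (koszul_acyclic_syzygy_up (@gdif i) h) => v;
  rewrite row_dif.
apply: (koszul_acyclic_syzygy_down (@gdif i) (@mdif i)).
by apply: eq_koszul_acyclic h => v; rewrite row_dif.
Qed.

(** Tor_i of [J] is Tor_0 of the module covered by F_i, and the basis of F_i generates that module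
    minimally. *)
Lemma res_deg_koszul i d :
  (exists a : 'I_(res_rank F i), res_deg a = d) <->
  ~ koszul_acyclic (fun _ : 'I_1 => 0) (ideal_module J) i d.
Proof.
suff : koszul_acyclic (fun _ : 'I_1 => 0) (ideal_module J) i d <->
   (forall a : 'I_(res_rank F i), res_deg a <> d).
  move=> ->; split=> [[a ad] h|h]; first exact: h ad.
  by apply: NNPP => h'; apply: h => a ad; apply: h'; exists a.
case: i => [|i].
  rewrite -(koszul_acyclic0_degrees gaug d maug).
  by split; apply: eq_koszul_acyclic => v; rewrite row_aug.
rewrite -(koszul_acyclic0_degrees (@gdif i) d (@mdif i)).
have := koszul_acyclic_syz i 0 d; rewrite addn0 => <-.
by split; apply: eq_koszul_acyclic => v; rewrite row_dif.
Qed.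

End Resolution.

Lemma betti_koszul J i j : (exists F, minimal_graded_free_resolution J F) ->
  betti J i j <> 0%N <-> ~ koszul_acyclic (fun _ : 'I_1 => 0) (ideal_module J) i j.
Proof.
move=> /(epsilon_spec (inhabits (zero_res K n))) FJ; rewrite -(res_deg_koszul FJ) /betti.
split=> [/eqP|[a aj]].
  by rewrite -lt0n card_gt0 => /set0Pn[a]; rewrite inE => /eqP; exists a.
by apply/eqP; rewrite -lt0n card_gt0; apply/set0Pn; exists a; rewrite inE; apply/eqP.
Qed.

(** As [reg] is an epsilon choice, a maximum has to be exhibited: the set is bounded by [D], and
    nonempty because a nonzero [J] forces F_0 to be nonzero. *)
Lemma reg_is_max J D : submodule (ideal_module J) ->
  (forall e v, ideal_module J v -> ideal_module J (vpart (fun _ : 'I_1 => 0) e v)) ->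
  (forall p d, D < d -> koszul_acyclic (fun _ : 'I_1 => 0) (ideal_module J) p d) ->
  (exists2 f, J f & f != 0) ->
  is_max (fun e => exists i j,
    ~ koszul_acyclic (fun _ : 'I_1 => 0) (ideal_module J) i j /\ e = j - i%:Z) (reg J).
Proof.
move=> sJ gJ bJ [f Jf f0]; have [F FJ] := min_res_exists sJ gJ bJ.
pose E e := exists i j, ~ koszul_acyclic (fun _ : 'I_1 => 0) (ideal_module J) i j /\ e = j - i%:Z.
have EE e : E e <-> (exists i j, betti J i j <> 0%N /\ e = j - i%:Z).
  have := fun i j => @betti_koszul J i j (ex_intro _ F FJ).
  by move=> h; split=> -[i [j [/h ? ?]]]; exists i, j.
have [e0 Ee0] : exists e, E e.
  case: (pickP (fun _ : 'I_(res_rank F 0) => true)) => [a _|h].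
    by exists (res_deg a - 0%N%:Z), 0%N, (res_deg a); split=> //;
      apply/(res_deg_koszul FJ); exists a.
  case: FJ => _ [h1 _ _] _; have [v fv] := (h1 f).1 Jf.
  by case/eqP: f0; rewrite fv mxE big1 // => a; have := h a.
have Eb e : E e -> e <= D.
  move=> [i [j [nac ->]]]; case: (lerP j D) => [|/(bJ i)/nac //]; lia.
have [|k Ek|k Ek kmax] := @ex_max_nat (fun k => E (e0 + k%:Z)) (absz (D - e0)).
- by exists 0%N; rewrite addr0.
- by have := Eb _ Ek; lia.
have [m1 m2] : is_max (fun e => exists i j, betti J i j <> 0%N /\ e = j - i%:Z) (reg J).
  apply: epsilon_spec; exists (e0 + k%:Z); split=> [|e /EE Ee]; first exact/EE.
  case: (lerP e e0) => [|lt]; first lia.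
  have := kmax (absz (e - e0)); have -> : e0 + (absz (e - e0))%:Z = e by lia.
  by move=> /(_ Ee); lia.
by split=> [|e /EE /m2 //]; apply/EE.
Qed.

End Regularity.

(** * Symbolic powers of squarefree monomial ideals via minimal covers *)

Section SymbolicPowers.

Variables (K : fieldType) (n : nat).
Local Notation S := {mpoly K[n]}.
Implicit Types (f g : S) (u w : 'X_{1..n}) (C : {set 'I_n}).

Definition wt C u := (\sum_(i in C) u i)%N.

Lemma wtD C u w : wt C (u + w)%MM = (wt C u + wt C w)%N.
Proof. by rewrite /wt -big_split; apply: eq_bigr => i _; rewrite mnmDE. Qed.

Lemma wt_gt0 C u : (0 < wt C u)%N -> exists2 i, i \in C & (0 < u i)%N.
Proof.
rewrite lt0n sum_nat_eq0 => /forallPn[i]; rewrite negb_imply -lt0n => /andP[iC ui].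
by exists i.
Qed.

Lemma wt_gt0_in C u i : i \in C -> (0 < u i)%N -> (0 < wt C u)%N.
Proof. by move=> iC ui; rewrite /wt (bigD1 i) //=; apply: leq_trans (leq_addr _ _). Qed.

(* The m-th power of the prime generated by the variables indexed by C. *)
Definition prime_pow C m f := forall u, u \in msupp f -> (m <= wt C u)%N.

Lemma prime_powX C m u : prime_pow C m 'X_[u] <-> (m <= wt C u)%N.
Proof.
split=> [|h w]; first by apply; rewrite msuppX inE.
by rewrite msuppX inE => /eqP->.
Qed.

Lemma prime_powM C a b f g : prime_pow C a f -> prime_pow C b g -> prime_pow C (a + b) (f * g).
Proof.
move=> hf hg u /msuppM_le/allpairsP[[v w] /= [/hf fv /hg gw ->]].
by rewrite wtD leq_add.
Qed.

Lemma prime_powD C m f g : prime_pow C m f -> prime_pow C m g -> prime_pow C m (f + g).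
Proof. by move=> hf hg u /msuppD_le; rewrite mem_cat => /orP[/hf|/hg]. Qed.

Lemma prime_powN C m f : prime_pow C m f -> prime_pow C m (- f).
Proof. by move=> hf u; rewrite (perm_mem (msuppN f)) => /hf. Qed.

Lemma prime_pow_ideal C m : is_ideal (prime_pow C m).
Proof.
split=> [u||c f hf]; [by rewrite msupp0 | exact: prime_powD |].
by rewrite -[m]add0n; apply: prime_powM.
Qed.

Lemma ideal_sum (I : S -> Prop) (T : eqType) (r : seq T) (F : T -> S) :
  is_ideal I -> (forall x, x \in r -> I (F x)) -> I (\sum_(x <- r) F x).
Proof. by move=> [I0 ID IM] h; rewrite big_seq; elim/big_ind: _. Qed.

Lemma ideal_gen_sub (I A : S -> Prop) f : is_ideal I -> (forall g, A g -> I g) ->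
  ideal_gen A f -> I f.
Proof.
move=> iI AI [s [sA ->]]; apply: ideal_sum => // x /sA/AI Ix.
by case: iI => _ _; apply.
Qed.

Lemma ideal_gen_ideal (A : S -> Prop) : is_ideal (ideal_gen A).
Proof.
split=> [|f g [s [sA ->]] [t [tA ->]]|c f [s [sA ->]]].
- by exists [::]; rewrite big_nil.
- exists (s ++ t); rewrite big_cat; split=> // x; rewrite mem_cat => /orP[/sA|/tA] //.
- exists [seq (c * x.1, x.2) | x <- s]; split=> [x /mapP[y /sA Ay ->] //|].
  by rewrite big_map mulr_sumr; apply: eq_bigr => x _; rewrite mulrA.
Qed.

Lemma mem_ideal_gen (A : S -> Prop) f : A f -> ideal_gen A f.
Proof.
move=> Af; exists [:: (1, f)]; rewrite big_seq1 mul1r; split=> // x.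
by rewrite inE => /eqP->.
Qed.

(* Compare the parts of lowest C-degree of both factors. *)
Lemma prime_pow_primary C m f g : ~ prime_pow C 1 g -> prime_pow C m (g * f) -> prime_pow C m f.
Proof.
move=> ng hgf; apply: NNPP => nf.
have [r [w fw wr] rmin] : exists2 r, (exists2 w, w \in msupp f & wt C w = r) &
    forall l, (exists2 w, w \in msupp f & wt C w = l) -> (r <= l)%N.
  apply: ex_min_nat; apply: NNPP => h; apply: nf => u fu; case: h.
  by exists (wt C u), u.
have rm : (r < m)%N.
  rewrite ltnNge; apply/negP => mr; apply: nf => u fu.
  by apply: leq_trans mr _; apply: rmin; exists u.
have [v gv wv] : exists2 v, v \in msupp g & wt C v = 0%N.
  apply: NNPP => h; apply: ng => u gu; rewrite lt0n; apply/negP => /eqP h0.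
  by apply: h; exists u.
pose f0 := msel (fun u => wt C u == r) f; pose g0 := msel (fun u => wt C u == 0%N) g.
have f0_nz : f0 != 0.
  by apply/eqP => /mpolyP/(_ w)/eqP; rewrite mcoeff_msel wr eqxx mcoeff0 mcoeff_eq0 fw.
have g0_nz : g0 != 0.
  by apply/eqP => /mpolyP/(_ v)/eqP; rewrite mcoeff_msel wv eqxx mcoeff0 mcoeff_eq0 gv.
have f0P u : u \in msupp f0 -> wt C u = r.
  by rewrite mcoeff_msupp mcoeff_msel; case: (eqVneq (wt C u) r) => // _; rewrite eqxx.
have g0P u : u \in msupp g0 -> wt C u = 0%N.
  by rewrite mcoeff_msupp mcoeff_msel; case: (eqVneq (wt C u) 0%N) => // _; rewrite eqxx.
have f1 : prime_pow C r.+1 (f - f0).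
  move=> u; rewrite mcoeff_msupp mcoeffB mcoeff_msel.
  case: (eqVneq (wt C u) r) => [_|ne]; first by rewrite subrr eqxx.
  rewrite subr0 -mcoeff_msupp ltn_neqAle eq_sym ne => fu.
  by apply: rmin; exists u.
have g1 : prime_pow C 1 (g - g0).
  move=> u; rewrite mcoeff_msupp mcoeffB mcoeff_msel lt0n.
  by case: (eqVneq (wt C u) 0%N) => [_|//]; rewrite subrr eqxx.
(* All monomials of [g0 * f0] have weight exactly [r], yet it differs from [g * f] by terms of
   weight above [r]; its leading monomial gives the contradiction. *)
have h : prime_pow C r.+1 (g0 * f0).
  have -> : g0 * f0 = g * f - (g0 * (f - f0) + (g - g0) * f0 + (g - g0) * (f - f0)).
    by rewrite !mulrBr !mulrBl; ring.
  apply: prime_powD; first by move=> u /hgf; apply: leq_trans.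
  apply/prime_powN/prime_powD; first apply: prime_powD.
  - by rewrite -[r.+1]add0n; apply: prime_powM.
  - by rewrite -add1n; apply: prime_powM => // u /f0P->.
  - move=> u uM; apply: (@leq_trans (1 + r.+1)%N) => //.
    exact: (prime_powM g1 f1).
have zM : mlead (g0 * f0) \in msupp (g0 * f0) by apply: mlead_supp; rewrite mulf_neq0.
have := h _ zM; have /allpairsP[[a b] /= [/g0P ga /f0P fb ->]] := msuppM_le zM.
by rewrite wtD ga fb ltnn.
Qed.

Lemma prime_pow1_prime C : prime_ideal (prime_pow C 1).
Proof.
split=> [||f g fg]; first exact: prime_pow_ideal.
  by rewrite -mpolyX0 prime_powX /wt big1 // => i _; rewrite mnmE.
case: (classic (prime_pow C 1 f)) => [|nf]; first by left.
by right; apply: prime_pow_primary nf fg.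
Qed.

Lemma prime_pow_prod C m (t : 'I_m -> S) : (forall i, prime_pow C 1 (t i)) ->
  prime_pow C m (\prod_i t i).
Proof.
move=> ht; rewrite -[m in prime_pow C m]card_ord -sum1_card.
apply: (big_ind2 (fun x y => prime_pow C y x)) => [u _||i _] //.
by move=> x1 x2 y1 y2; exact: prime_powM.
Qed.

Lemma ideal_powS (I : S -> Prop) m f g : ideal_pow I m f -> I g -> ideal_pow I m.+1 (f * g).
Proof.
move=> [s [sI ->]] Ig; exists [seq (x.1, x.2 * g) | x <- s]; split.
  move=> y /mapP[x /sI[t tI xt] ->] /=.
  exists (fun i => if unlift ord_max i is Some j then t j else g) => [i|].
    by case: unliftP.
  rewrite big_ord_recr /= unlift_none xt; congr (_ * _); apply: eq_bigr => i _.
  have -> : widen_ord (leqnSn m) i = fintype.lift ord_max i.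
    by apply: val_inj; rewrite /= /bump leqNgt ltn_ord.
  by rewrite fintype.liftK.
by rewrite big_map mulr_suml; apply: eq_bigr => x _; rewrite mulrA.
Qed.

Lemma ideal_pow0 (I : S -> Prop) f : ideal_pow I 0 f.
Proof.
exists [:: (f, 1)]; rewrite big_seq1 mulr1; split=> // x.
by rewrite inE => /eqP->; exists (fun _ => 0); [case | rewrite big_ord0].
Qed.

Section SquarefreeMonomial.

Variables (I : S -> Prop) (A : 'X_{1..n} -> Prop).
Hypothesis A_sqf : forall u, A u -> forall i, (u i <= 1)%N.
Hypothesis IA : forall f, I f <-> ideal_gen (fun g => exists2 u, A u & g = 'X_[u]) f.

Definition cover_of C := forall u, A u -> (0 < wt C u)%N.
Definition min_cover C := cover_of C /\ forall C', C' \subset C -> cover_of C' -> C' = C.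

Lemma I_ideal : is_ideal I.
Proof.
have [h0 hD hM] := ideal_gen_ideal (fun g : S => exists2 u, A u & g = 'X_[u]).
split=> [|f g /IA If /IA Ig|c f /IA If]; apply/IA => //; [exact: hD | exact: hM].
Qed.

Lemma I_mon u : A u -> I 'X_[u].
Proof. by move=> Au; apply/IA; apply: mem_ideal_gen; exists u. Qed.

Lemma I_sub_prime C f : cover_of C -> I f -> prime_pow C 1 f.
Proof.
move=> CC /IA; apply: ideal_gen_sub; first exact: prime_pow_ideal.
by move=> g [u /CC Au ->]; apply/prime_powX.
Qed.

Lemma prime_monomial (P : S -> Prop) u : prime_ideal P -> P 'X_[u] ->
  exists2 i, (0 < u i)%N & P 'X_i.
Proof.
move=> [[_ _ PM] P1 Pp]; have [k] := ubnP (mdeg u); elim: k u => // k IH u uk Pu.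
case: (pickP (fun i => 0 < u i)%N) => [i ui|u0]; last first.
  case: P1; rewrite -mpolyX0; have <- // : u = 0%MM.
  by apply/mnmP => i; rewrite mnmE; have := u0 i; case: (u i).
have uE : (u = (u - U_(i)) + U_(i))%MM by rewrite submK // lep1mP -lt0n.
have := Pu; rewrite {1}uE mpolyXD => /Pp[|Pi]; last by exists i.
move=> /IH[|j uj Pj]; first by move: uk; rewrite {1}uE mdegD mdeg1; lia.
by exists j => //; move: uj; rewrite mnmE; lia.
Qed.

Definition vars_in (P : S -> Prop) : {set 'I_n} :=
  [set i | if excluded_middle_informative (P 'X_i) then true else false].

Lemma vars_inP (P : S -> Prop) i : i \in vars_in P <-> P 'X_i.
Proof. by rewrite inE; case: excluded_middle_informative. Qed.

Lemma vars_cover (P : S -> Prop) : prime_ideal P -> (forall f, I f -> P f) ->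
  cover_of (vars_in P).
Proof.
move=> pP IP u /I_mon/IP/(prime_monomial pP)[i ui /vars_inP Pi].
exact: wt_gt0_in Pi ui.
Qed.

Lemma prime_pow_vars (P : S -> Prop) f : prime_ideal P -> prime_pow (vars_in P) 1 f -> P f.
Proof.
move=> [iP _ _] hf; rewrite [f]mpolyE;
  apply: ideal_sum => // u /hf/wt_gt0[i /vars_inP Pi ui].
have uE : (u = (u - U_(i)) + U_(i))%MM by rewrite submK // lep1mP -lt0n.
by rewrite uE mpolyXD scalerAl; case: iP => _ _; apply.
Qed.

Lemma prime_powXi C i : prime_pow C 1 'X_i <-> i \in C.
Proof.
rewrite prime_powX; split=> [/wt_gt0[j jC]|iC].
  by rewrite mnmE; case: eqP => // ->.
by apply: (wt_gt0_in iC); rewrite mnmE eqxx.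
Qed.

(** The variables in [P] generate a prime that contains [I] and lies in [P], hence equals [P]; a
    smaller cover would give a smaller prime over [I]. *)
Lemma minimal_prime_cover (P : S -> Prop) : minimal_prime I P ->
  exists2 C, min_cover C & forall f, P f <-> prime_pow C 1 f.
Proof.
move=> [pP IP Pmin]; have CC := vars_cover pP IP.
have PC f : P f <-> prime_pow (vars_in P) 1 f.
  split; last exact: prime_pow_vars.
  apply: Pmin; [exact: prime_pow1_prime | by move=> g; exact: I_sub_prime |].
  by move=> g; exact: prime_pow_vars.
exists (vars_in P) => //; split=> // C' C'C cC'.
apply/eqP; rewrite eqEsubset C'C; apply/subsetP => i /vars_inP Pi.
apply/prime_powXi; move: Pi; apply: Pmin; first exact: prime_pow1_prime.
  by move=> g; exact: I_sub_prime.
move=> g hg; apply/PC => u /hg/wt_gt0[k kC' uk].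
by apply: wt_gt0_in uk; exact: (subsetP C'C).
Qed.

Lemma cover_minimal_prime C : min_cover C -> minimal_prime I (prime_pow C 1).
Proof.
move=> [cC Cmin]; split; first exact: prime_pow1_prime.
  by move=> f; exact: I_sub_prime.
move=> Q pQ IQ QC f; rewrite -(Cmin (vars_in Q)); first exact: prime_pow_vars.
  by apply/subsetP => i /vars_inP/QC/prime_powXi.
exact: vars_cover.
Qed.

(** Forward, I^m lies in the m-th power of each minimal prime, and that power is primary. Backward,
    each monomial is brought into I^m by multiplying with [z m], the m-th power of the product of
    the variables off [C], which is outside the prime. *)
Lemma symbolic_powerP m f :
  symbolic_power I m f <-> forall u, u \in msupp f -> forall C, min_cover C -> (m <= wt C u)%N.
Proof.
split=> [h u fu C mC|h P /minimal_prime_cover[C mC PC]].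
  have [g ng] := h _ (cover_minimal_prime mC); rewrite /= !mul1r subr0 => gf.
  have : prime_pow C m (g * f).
    move: gf; apply: ideal_gen_sub; first exact: prime_pow_ideal.
    move=> x [t tI ->]; apply: prime_pow_prod => i; apply: I_sub_prime => //.
    by case: mC.
  by move/(prime_pow_primary ng); apply.
have [cC Cmin] := mC.
pose z k : 'X_{1..n} := [multinom (if i \in C then 0 else k)%N | i < n].
exists 'X_[z m] => /=.
  move/PC/prime_powX; rewrite /wt big1 // => i iC; by rewrite mnmE iC.
rewrite !mul1r subr0 [f]mpolyE mulr_sumr.
apply: ideal_sum => [|u /h/(_ _ mC)]; first exact: ideal_gen_ideal.
have edge_in i : i \in C -> I 'X_[(U_(i) + z 1%N)].
  (* By minimality [C :\ i] misses a generator x^v. Being squarefree and meeting [C] at most in [i],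
     it divides x_i times the product of the variables off [C]. *)
  move=> iC; have [v Av v0] : exists2 v, A v & wt (C :\ i) v = 0%N.
    apply: NNPP => hv; have /setP/(_ i) : C :\ i = C.
      apply: Cmin; first exact: subD1set.
      by move=> v Av; rewrite lt0n; apply/negP => /eqP v0; apply: hv; exists v.
    by rewrite !inE eqxx iC.
  have vle : (v <= U_(i) + z 1%N)%MM.
    apply/mnm_lepP => k; rewrite !mnmE; have := A_sqf Av k.
    case: eqP => [_|/eqP ik] /=; first by lia.
    case: ifP => // kC _; move/eqP: v0; rewrite /wt sum_nat_eq0 => /forall_inP/(_ k).
    by rewrite !inE eq_sym ik kC => /(_ isT)/eqP->.
  rewrite -(submK vle) mpolyXD; case: I_ideal => _ _; apply; exact: I_mon.
rewrite -scalerAr -mul_mpolyC => hu.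
case: (ideal_gen_ideal (fun f : S => exists2 t : 'I_m -> S, forall i : 'I_m, I (t i) & f = \prod_i t i)) => _ _; apply.
rewrite -mpolyXD -/(ideal_pow I m _); elim: m u hu {h mC} => [|m IH] u hu;
  first exact: ideal_pow0.
have [i iC ui] : exists2 i, i \in C & (0 < u i)%N by apply: wt_gt0; exact: leq_trans hu.
have uE : (u = (u - U_(i)) + U_(i))%MM by rewrite submK // lep1mP -lt0n.
(* One factor x_i with [i] in [C] is paired with one copy of [z 1], which splits off an element of
   [I]. *)
have -> : (z m.+1 + u = (z m + (u - U_(i))) + (U_(i) + z 1%N))%MM.
  rewrite {1}uE; apply/mnmP => k; rewrite !mnmE; case: ifP; lia.
rewrite mpolyXD; apply: ideal_powS; last exact: edge_in.
apply: IH; have := hu; rewrite {1}uE wtD; suff -> : wt C U_(i) = 1%N by rewrite addn1.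
rewrite /wt (bigD1 i) //= mnmE eqxx big1 // => k /andP[_ ki].
by rewrite mnmE eq_sym (negbTE ki).
Qed.

Lemma min_cover_nonempty C : (exists2 f, I f & f != 0) -> min_cover C -> C != set0.
Proof.
move=> [f If f0] [cC _]; apply: contraNneq f0 => C0.
have /IA[s [sA ->]] := If; rewrite big_seq big1 // => x /sA[u Au _].
by have := cC u Au; rewrite C0 /wt big_set0.
Qed.

(** A cover of least cardinality is minimal; the full set is a cover because a generator 1 would
    make [I] everything. *)
Lemma min_cover_exists : (exists f, ~ I f) -> exists C, min_cover C.
Proof.
move=> [f nIf].
have [m [C cC Cm] mmin] : exists2 m, (exists2 C, cover_of C & #|C| = m) &
    forall l, (exists2 C, cover_of C & #|C| = l) -> (m <= l)%N.
  apply: ex_min_nat; exists #|[set: 'I_n]|, setT => // u Au.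
  rewrite lt0n; apply/negP => /eqP u0; apply: nIf.
  have [_ _ hM] := I_ideal; rewrite -[f]mulr1; apply: hM; rewrite -mpolyX0.
  have <- : u = 0%MM; last exact: I_mon.
  apply/eqP; rewrite -mdeg_eq0 mdegE; apply/eqP; rewrite -[RHS]u0; apply: eq_bigl => i;
    by rewrite inE.
exists C; split=> // C' C'C cC'; apply/eqP; rewrite eqEcard C'C Cm.
by apply: mmin; exists C'.
Qed.

End SquarefreeMonomial.

End SymbolicPowers.

(** * Regularity of symbolic powers and its growth *)

Section SymbolicPowerRegularity.

Variables (K : fieldType) (n : nat) (I : {mpoly K[n]} -> Prop) (A : 'X_{1..n} -> Prop).
Local Notation S := {mpoly K[n]}.
Hypothesis A_sqf : forall u, A u -> forall i, (u i <= 1)%N.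
Hypothesis IA : forall f, I f <-> ideal_gen (fun g => exists2 u, A u & g = 'X_[u]) f.

Definition symbolic_exponent m u := forall C, min_cover A C -> (m <= wt C u)%N.

Local Notation J m := (ideal_module (symbolic_power I m)).
Local Notation acyclicJ m := (koszul_acyclic (fun _ : 'I_1 => 0) (J m)).
Local Notation cellJ m a := (cell (symbolic_exponent m) a).
Local Notation acyclic := (@simplicial_acyclic n K K^o).

Lemma ideal_module_monomial m v :
  J m v <-> @monomial_module K n (symbolic_exponent m) 1 v.
Proof.
rewrite /ideal_module (symbolic_powerP A_sqf IA); split=> [h b u|h u]; last exact: h.
by rewrite ord1; exact: h.
Qed.

Lemma symbolic_submodule m : submodule (J m).
Proof.
split=> [|v w /ideal_module_monomial hv /ideal_module_monomial hw|f v /ideal_module_monomial hv];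
  apply/ideal_module_monomial => b u; rewrite mxE.
- by rewrite msupp0.
- by move/msuppD_le; rewrite mem_cat => /orP[/hv|/hw].
- move/msuppM_le/allpairsP => [[a c] /= [_ /hv vc ->]] C CC.
  by rewrite wtD; apply: leq_trans (vc C CC) (leq_addl _ _).
Qed.

Lemma symbolic_vpart m e v : J m v -> J m (vpart (fun _ : 'I_1 => 0) e v).
Proof.
move=> /ideal_module_monomial hv; apply/ideal_module_monomial => b u.
rewrite mxE mcoeff_msupp mcoeff_hpart; case: ifP => _; last by rewrite eqxx.
by rewrite -mcoeff_msupp; exact: hv.
Qed.

(** Reconciles the two conventions: [below] subtracts 1 on the face, while the box keeps [a] there,
    adds 1 off it, and [cover_pow] takes predecessors. *)
Lemma cell_box m a s : cellJ m a s <-> box (cover_pow (min_cover A) m) a (succm a) s.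
Proof.
have e i : pos_on a s -> (mix a (succm a) s i).-1 = below a s i.
  by move=> /forall_inP as_; rewrite !mnmE; case: ifP => [/as_|_]; lia.
split=> [[as_ sC]|[c0 cC]].
  split=> [i|C CC]; first by rewrite !mnmE; case: ifP => // /(forall_inP as_).
  by apply: leq_trans (sC C CC) _; apply: leq_sum => i _; rewrite e.
have as_ : pos_on a s.
  by apply/forall_inP => i is_; have := c0 i; rewrite !mnmE is_.
split=> // C CC; apply: leq_trans (cC C CC) _; apply: leq_sum => i _; by rewrite e.
Qed.

(** A multidegree of size above nm has an entry above [m], so its cell is a cone. This is the bound,
    uniform in [p], that [reg_is_max] needs. *)
Lemma symbolic_koszul_large m p d : (n * m)%N%:Z < d -> acyclicJ m p d.
Proof.
move=> nd; apply: (@eq_koszul_acyclic _ _ _ _ (@monomial_module K n (symbolic_exponent m) 1)).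
  by move=> v; rewrite ideal_module_monomial.
apply: koszul_acyclic_strands => _ a; rewrite subr0 => ad.
case: (pickP (fun v => m < a v)%N) => [v mv|am].
  by apply: (eq_acyclic _ (cell_acyclic_large mv)) => s; apply: iff_sym; exact: cell_box.
suff : (mdeg a <= n * m)%N by lia.
rewrite mdegE -[n in (_ <= n * _)%N]card_ord -sum_nat_const; apply: leq_sum => i _.
by rewrite leqNgt am.
Qed.

Lemma koszul_cell m p d :
  ~ acyclicJ m p d <-> exists2 a, (mdeg a)%:Z = d & ~ acyclic (cellJ m a) p.
Proof.
have e : acyclicJ m p d <-> koszul_acyclic (fun _ : 'I_1 => 0)
           (@monomial_module K n (symbolic_exponent m) 1) p d.
  by split; apply: eq_koszul_acyclic => v; rewrite ideal_module_monomial.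
rewrite e; split=> [nac|[a <- nac] h]; last by apply: nac; exact: strands_koszul_acyclic h.
apply: NNPP => h; apply: nac; apply: koszul_acyclic_strands => _ a; rewrite subr0 => ad.
by apply: NNPP => nac; apply: h; exists a.
Qed.

Hypotheses (hI0 : exists2 f, I f & f != 0) (hI1 : exists f, ~ I f).

Lemma symbolic_power_neq0 m : exists2 f, symbolic_power I m f & f != 0.
Proof.
pose u : 'X_{1..n} := [multinom m | _ < n]; exists 'X_[u]; last first.
  by rewrite -msupp_eq0 msuppX.
apply/(symbolic_powerP A_sqf IA) => w; rewrite msuppX inE => /eqP-> C mC.
have /set0Pn[i iC] := min_cover_nonempty IA hI0 mC.
by rewrite /wt (bigD1 i) //= mnmE leq_addr.
Qed.

Lemma reg_symbolic_power m :
  is_max (fun e => exists i a, ~ acyclic (cellJ m a) i /\ e = (mdeg a)%:Z - i%:Z)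
    (reg (symbolic_power I m)).
Proof.
have [[i [j [/koszul_cell[a <- nac] re]]] rmax] := reg_is_max (symbolic_submodule m)
  (@symbolic_vpart m) (@symbolic_koszul_large m) (symbolic_power_neq0 m).
split=> [|e [k [b [nb ->]]]]; first by exists i, a.
by apply: rmax; exists k, (mdeg b)%:Z; split=> //; apply/koszul_cell; exists b.
Qed.

Lemma cell_degree_bound m a p : ~ acyclic (cellJ m a) p -> (mdeg a <= n * m)%N.
Proof.
move=> nac; rewrite leqNgt; apply/negP => h.
have : ~ acyclicJ m p (mdeg a) by apply/koszul_cell; exists a.
by apply; apply: symbolic_koszul_large.
Qed.

Lemma reg_symbolic_power_scale m m' k : (0 < m)%N -> (k.+1 * m.-1 < m' <= k.+1 * m)%N ->
  reg (symbolic_power I m) + m'%:Z <= reg (symbolic_power I m') + m%:Z.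
Proof.
move=> m0 mm'; have [[i0 [a0 [na0 re0]]] rmax] := reg_symbolic_power m.
set rg := reg (symbolic_power I m) in re0 rmax *.
(* Among the multidegrees realizing the regularity, one of largest size [d] is taken. *)
have [||d [i [a [nac ad re]]] dmax] := @ex_max_nat (fun d => exists i a,
  [/\ ~ acyclic (cellJ m a) i, mdeg a = d & rg = d%:Z - i%:Z]) (n * m).
- by exists (mdeg a0), i0, a0.
- by move=> k0 [i [a [/cell_degree_bound ak <- _]]].
have acE m1 b q : acyclic (cellJ m1 b) q <-> acyclic (box (cover_pow (min_cover A) m1) b (succm b)) q.
  by split; apply: eq_acyclic => s; [|apply: iff_sym]; exact: cell_box.
have amax (b : 'X_{1..n}) : (forall v, a v <= b v)%N -> b <> a ->
    acyclic (box (cover_pow (min_cover A) m) b (succm b)) i.+1.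
  move=> ab ba; apply/acE; apply: NNPP => nb.
  have lt_ab : (mdeg a < mdeg b)%N.
    have bE : b = (a + (b - a))%MM by rewrite addmC submK //; apply/mnm_lepP.
    rewrite bE mdegD -[X in (X < _)%N]addn0 ltn_add2l lt0n mdeg_eq0.
    by apply/eqP => h; apply: ba; rewrite bE h addm0.
  (* From |b| - (i+1) <= |a| - i and |b| > |a| follows |b| = |a| + 1, so [b] would realize the
     regularity with larger size. *)
  have le_r : (mdeg b)%:Z - i.+1%:Z <= rg by apply: rmax; exists i.+1, b.
  have : (mdeg b <= d)%N by apply: dmax; exists i.+1, b; split=> //; lia.
  lia.
have [|b nb ab] := cell_scale m0 mm' (min_cover_exists IA hI1) amax; first by move/acE.
have [_ rmax'] := reg_symbolic_power m'.
have : (mdeg b)%:Z - i%:Z <= reg (symbolic_power I m').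
  by apply: rmax'; exists i, b; split=> // /acE.
by rewrite re -ad; lia.
Qed.

End SymbolicPowerRegularity.

Theorem theorem3p1 (K : fieldType) (n : nat) (I : {mpoly K[n]} -> Prop)
    (hI : squarefree_monomial_ideal I)
    (hI0 : exists2 f, I f & f != 0)
    (hI1 : exists f, ~ I f)
    (m k : nat) (hm : (0 < m)%N) (hk : (0 < k)%N)
    (j : int) (hj1 : m%:Z - k%:Z <= j) (hj2 : j <= m%:Z) :
  reg (symbolic_power I m) + (k%:Z - 1) * m%:Z + j
    <= reg (symbolic_power I (absz (k%:Z * m%:Z + j))).
Proof.
have [A A_sqf IA] := hI.
(* Here km + j >= (k+1)m - k >= 1, so the absolute value changes nothing. *)
have mE : (absz (k%:Z * m%:Z + j))%:Z = k%:Z * m%:Z + j by rewrite gez0_abs; nia.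
have := reg_symbolic_power_scale (m' := absz (k%:Z * m%:Z + j)) (k := k) A_sqf IA hI0 hI1 hm.
rewrite mE mulrBl mul1r => h.
(* The bound j >= m - k gives km + j >= (k+1)(m-1) + 1, and j <= m gives km + j <= (k+1)m. *)
have /h : (k.+1 * m.-1 < absz (k%:Z * m%:Z + j)%R <= k.+1 * m)%N.
  have : (m.-1.+1 = m)%N by lia.
  move: mE; set m' := absz _; rewrite -PoszM => mE me; apply/andP; split; nia.
lia.
Qed.
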